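(* Let $V\subseteq\mathcal V$ be finite, $\mathbb E,\mathbb F\in\mathit{NProg}(V)$, and $V'\subseteq\mathcal V$ with $|V'|=|V|$ and $V\cap V'=\emptyset$. Then (1) $\mathbb E\le_T^s\mathbb F$ iff $\mathbb F\models_{tot}(\mathbb E^\dagger(\{\Omega_{V,V'}\}),\{\Omega_{V,V'}\})$; (2) $\mathbb E\le_P^s\mathbb F$ iff $\mathbb F\models_{par}(I-\mathbb E^\dagger(\{\Omega_{V,V'}\}),\{I-\Omega_{V,V'}\})$.
   Context: $\mathcal V$ is a countably infinite set of qubit variables; $\mathcal H_V=\bigotimes_{q\in V}\mathcal H_q$. $\mathcal D(\mathcal H)$: partial density operators; $\mathcal P(\mathcal H)$: effects. $\mathit{DProg}(V)$: completely positive trace-nonincreasing super-operators on $\mathcal L(\mathcal H_V)$; $\mathit{NProg}(V)$: nonempty convex closed subsets of $\mathit{DProg}(V)$. Operators/super-operators on subsystems are implicitly extended by tensoring with identities. $\mathcal E^\dagger$ is the adjoint (${\rm tr}(\mathcal E(A)B)={\rm tr}(A\mathcal E^\dagger(B))$); for a set of effects $\Psi$, $\mathbb E^\dagger(\Psi)=\{\mathcal E^\dagger(N):\mathcal E\in\mathbb E,N\in\Psi\}$ (this is $wp^s.\mathbb E.\Psi$), and $I-\Theta=\{I-M:M\in\Theta\}$ (so $I-\mathbb E^\dagger(I-\Psi)=wlp^s.\mathbb E.\Psi$). With $d=2^{|V|}$, $\Omega_{V,V'}=|\omega\rangle\langle\omega|$, $|\omega\rangle=\frac1{\sqrt d}\sum_i|i\rangle_V|i\rangle_{V'}$,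 and $I$ is the identity on $\mathcal H_V\otimes\mathcal H_{V'}$. $\mathrm{Exp}_{dem}(\rho\models\Theta)=\inf_{M\in\Theta}{\rm tr}(M\rho)$ (${\rm tr}(\rho)$ if $\Theta=\emptyset$). $\mathbb E\models_{tot}(\Theta,\Psi)$ iff for all finite $X\supseteq V\cup W$ and $\rho\in\mathcal D(\mathcal H_X)$, $\mathrm{Exp}_{dem}(\rho\models\Theta)\le\inf_{\mathcal E\in\mathbb E}\mathrm{Exp}_{dem}(\mathcal E(\rho)\models\Psi)$; $\mathbb E\models_{par}(\Theta,\Psi)$ iff for all such $X,\rho$, $\mathrm{Exp}_{dem}(\rho\models\Theta)\le\inf_{\mathcal E\in\mathbb E}[\mathrm{Exp}_{dem}(\mathcal E(\rho)\models\Psi)+{\rm tr}(\rho)-{\rm tr}(\mathcal E(\rho))]$. $\mathbb E\le_T^s\mathbb F$ (resp. $\le_P^s$) iff for every finite $W$ and all $\Theta,\Psi\subseteq\mathcal P(\mathcal H_W)$, $\mathbb E\models_{tot}(\Theta,\Psi)\Rightarrow\mathbb F\models_{tot}(\Theta,\Psi)$ (resp. with $\models_{par}$). *)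

(* Defs.v *)
From HB Require Import structures.
From mathcomp Require Import all_boot all_order all_algebra.
From mathcomp Require Import finmap.
From mathcomp Require Import complex.
From mathcomp Require Import all_classical all_reals all_analysis.

Unset Printing Implicit Defensive.

Import Order.TTheory GRing.Theory Num.Theory.
Import numFieldTopology.Exports numFieldNormedType.Exports.
Local Open Scope ring_scope.
Local Open Scope classical_set_scope.

(* Qubit variables: the countably infinite set nat.  Finite sets of
   variables: {fset nat}.  The computational basis of H_X (X finite) is
   indexed by the assignments st X = {ffun X -> bool}; operators on H_X are
   matrices indexed by st X, with entries in the complex numbers R[i]. *)

Section Quantum.
Context {R : realType}.
Notation C := R[i].

Definition st (X : {fset nat}) := {ffun X -> bool}.
Definition Op (X : {fset nat}) := st X -> st X -> C.

(* value of qubit q in basis state s (false if q is not in X) *)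
Definition val_at (X : {fset nat}) (s : st X) (q : nat) : bool :=
  if insub q is Some x then s x else false.

Definition restr (V X : {fset nat}) (s : st X) : st V :=
  [ffun v : V => val_at X s (val v)].

Definition merge (V X : {fset nat}) (a : st V) (s : st X) : st X :=
  [ffun x : X => if val x \in V then val_at V a (val x) else s x].

Definition agree_off (V X : {fset nat}) (s t : st X) : bool :=
  [forall x : X, (val x \notin V) ==> (s x == t x)].

(* A |-> A (x) I_{X \ V}  (for V \subseteq X) *)
Definition ext (V X : {fset nat}) (A : Op V) : Op X :=
  fun s t => if agree_off V X s t then A (restr V X s) (restr V X t) else 0.

(* E |-> E (x) id_{X \ V} on L(H_X)  (for V \subseteq X) *)
Definition extS (V X : {fset nat}) (E : Op V -> Op V) : Op X -> Op X :=
  fun rho s t => E (fun a b => rho (merge V X a s) (merge V X b t)) (restr V X s) (restr V X t).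

Definition mulO (X : {fset nat}) (A B : Op X) : Op X :=
  fun s t => \sum_(u : st X) A s u * B u t.
Definition trO (X : {fset nat}) (A : Op X) : C := \sum_(s : st X) A s s.
Definition idOp (X : {fset nat}) : Op X := fun s t => (s == t)%:R.
Definition subO (X : {fset nat}) (A B : Op X) : Op X := fun s t => A s t - B s t.
Definition unitO (X : {fset nat}) (s0 t0 : st X) : Op X :=
  fun s t => ((s == s0) && (t == t0))%:R.

(* positive semidefinite (hence Hermitian): <v|A|v> is real and >= 0 *)
Definition psd (X : {fset nat}) (A : Op X) : Prop :=
  forall v : st X -> C, 0 <= \sum_(s : st X) \sum_(t : st X) (v s)^* * A s t * v t.

Definition density (X : {fset nat}) (rho : Op X) : Prop := psd X rho /\ trO X rho <= 1.
Definition effect (X : {fset nat}) (M : Op X) : Prop := psd X M /\ psd X (subO X (idOp X) M).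

Definition linearS (V : {fset nat}) (E : Op V -> Op V) : Prop :=
  forall (a : C) (A B : Op V),
    E (fun s t => a * A s t + B s t) = (fun s t => a * E A s t + E B s t).
Definition complete_pos (V : {fset nat}) (E : Op V -> Op V) : Prop :=
  forall X : {fset nat}, fsubset V X ->
    forall rho : Op X, psd X rho -> psd X (extS V X E rho).
Definition trace_nonincr (V : {fset nat}) (E : Op V -> Op V) : Prop :=
  forall rho : Op V, psd V rho -> trO V (E rho) <= trO V rho.

Definition DProg (V : {fset nat}) : set (Op V -> Op V) :=
  [set E | linearS V E /\ complete_pos V E /\ trace_nonincr V E].

Definition cvgC (u : nat -> C) (z : C) : Prop :=
  ((fun n => complex.Re (u n)) @ \oo --> complex.Re z) /\
  ((fun n => complex.Im (u n)) @ \oo --> complex.Im z).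

Definition convexS (V : {fset nat}) (EE : set (Op V -> Op V)) : Prop :=
  forall (E1 E2 : Op V -> Op V) (p : R), EE E1 -> EE E2 -> 0 <= p <= 1 ->
    EE (fun A s t => (p%:C)%C * E1 A s t + ((1 - p)%:C)%C * E2 A s t).

(* closed (sequentially, in the finite-dimensional space of super-operators) *)
Definition closedS (V : {fset nat}) (EE : set (Op V -> Op V)) : Prop :=
  forall (u : nat -> Op V -> Op V) (E : Op V -> Op V),
    (forall n, EE (u n)) ->
    (forall A s t, cvgC (fun n => u n A s t) (E A s t)) -> EE E.

Definition NProg (V : {fset nat}) (EE : set (Op V -> Op V)) : Prop :=
  EE `<=` DProg V /\ EE !=set0 /\ convexS V EE /\ closedS V EE.

(* adjoint: tr(F(A) B) = tr(A F^dagger(B)) *)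
Definition adjS (X : {fset nat}) (F : Op X -> Op X) : Op X -> Op X :=
  fun B t s => trO X (mulO X (F (unitO X s t)) B).

Definition wpS (V W : {fset nat}) (EE : set (Op V -> Op V)) (Psi : set (Op W))
  : set (Op W) :=
  [set M | exists E N, EE E /\ Psi N /\ M = adjS W (extS V W E) N].

Definition complS (W : {fset nat}) (Theta : set (Op W)) : set (Op W) :=
  [set subO W (idOp W) M | M in Theta].

Definition ExpDem (X W : {fset nat}) (rho : Op X) (Theta : set (Op W)) : R :=
  if `[< Theta = set0 >] then complex.Re (trO X rho)
  else inf [set complex.Re (trO X (mulO X (ext W X M) rho)) | M in Theta].

Definition models_tot (V W : {fset nat}) (EE : set (Op V -> Op V))
  (Theta Psi : set (Op W)) : Prop :=
  forall X : {fset nat}, fsubset (V `|` W)%fset X ->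
  forall rho : Op X, density X rho ->
    ExpDem X W rho Theta <= inf [set ExpDem X W (extS V X E rho) Psi | E in EE].

Definition models_par (V W : {fset nat}) (EE : set (Op V -> Op V))
  (Theta Psi : set (Op W)) : Prop :=
  forall X : {fset nat}, fsubset (V `|` W)%fset X ->
  forall rho : Op X, density X rho ->
    ExpDem X W rho Theta <=
      inf [set ExpDem X W (extS V X E rho) Psi + complex.Re (trO X rho)
               - complex.Re (trO X (extS V X E rho)) | E in EE].

Definition refT (V : {fset nat}) (EE FF : set (Op V -> Op V)) : Prop :=
  forall (W : {fset nat}) (Theta Psi : set (Op W)),
    Theta `<=` effect W -> Psi `<=` effect W ->
    models_tot V W EE Theta Psi -> models_tot V W FF Theta Psi.

Definition refP (V : {fset nat}) (EE FF : set (Op V -> Op V)) : Prop :=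
  forall (W : {fset nat}) (Theta Psi : set (Op W)),
    Theta `<=` effect W -> Psi `<=` effect W ->
    models_par V W EE Theta Psi -> models_par V W FF Theta Psi.

(* the k-th smallest variable of V is paired with the k-th smallest of V' *)
Definition partner (V V' : {fset nat}) (q : nat) : nat :=
  nth 0%N (sort leq V') (index q (sort leq V)).

(* Omega_{V,V'} = |omega><omega|, omega = d^{-1/2} sum_i |i>_V |i>_V' *)
Definition Omega (V V' : {fset nat}) : Op (V `|` V')%fset :=
  let matched (s : st (V `|` V')%fset) :=
    [forall v : V, val_at (V `|` V')%fset s (val v) ==
                   val_at (V `|` V')%fset s (partner V V' (val v))] in
  fun s t => if matched s && matched t then ((2 ^ #|` V|)%N%:R)^-1 else 0.

End Quantum.

(* Main.v *)
Require Import Defs.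
From HB Require Import structures.
From mathcomp Require Import all_boot all_order all_algebra.
From mathcomp Require Import finmap.
From mathcomp Require Import complex.
From mathcomp Require Import all_classical all_reals all_analysis.
From mathcomp Require Import ring lra.
Import Order.TTheory GRing.Theory Num.Theory.
(* Un-shadows [ext] and [merge]. *)
Import Defs.
Import numFieldTopology.Exports numFieldNormedType.Exports.
Local Open Scope ring_scope.
Local Open Scope classical_set_scope.

(* A positive-semidefinite matrix indexed by pairs of basis states of [V] is
   the Choi matrix of a completely positive map, and for every super-operator
   [E] the effect [E^dagger(Omega)] is, up to transposition and the factor
   [1/d], the Choi matrix of [E].  The right-hand side of (1) therefore says
   that for each [F] in [FF] and each state [rho] some [E] in [EE] satisfies
   [tr (J_E rho) <= tr (J_F rho)] up to an arbitrarily small error.  As [EE] is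
   convex and compact, a minimax argument (separation of a convex set from the
   self-dual cone of positive matrices) makes [E] independent of [rho]:
   [J_E <= J_F], so [F - E] is completely positive and [F] inherits every
   total-correctness formula of [E].  For (2) all the inequalities between
   [E] and [F] are reversed. *)

(** No compactness theorem enters: a lemma on almost norm-minimal points of nested convex sets
    supplies the limits. It serves twice, for the point nearest to 0 in the differences of [K] and
    the cone, and then for a convergent sequence in [K] whose limit lies in the cone; sequential
    closedness of [EE] turns that limit into a program. The infimum on the left of a formula yields
    a minimiser only up to an error, hence the tolerances [d]. Both parts run through one statement
    with a sign [e], [e * e = 1]: complementing an effect replaces [tr (M rho)] by
    [tr rho - tr (M rho)], the terms [tr rho] cancel, and only the direction of the order
    changes. *)

(** * Euclidean geometry: nearest points, separation from a cone, minimax *)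

Definition dotR {R : realType} {T : finType} (x y : T -> R) : R :=
  \sum_t x t * y t.

Definition convexR {R : realType} {T : Type} (A : set (T -> R)) : Prop :=
  forall x y p, A x -> A y -> 0 <= p <= 1 ->
    A (fun t => p * x t + (1 - p) * y t).

Lemma dotRC (R : realType) (T : finType) (x y : T -> R) : dotR x y = dotR y x.
Proof. by apply: eq_bigr => t _; rewrite mulrC. Qed.

Lemma dotR_lin (R : realType) (T : finType) (a b : R) (x y z : T -> R) :
  dotR (fun t => a * x t + b * y t) z = a * dotR x z + b * dotR y z.
Proof.
rewrite /dotR !mulr_sumr -big_split; apply: eq_bigr => t _ /=; ring.
Qed.

Lemma dotR_ge0 (R : realType) (T : finType) (x : T -> R) : 0 <= dotR x x.
Proof. by apply: sumr_ge0 => t _; rewrite -expr2 sqr_ge0. Qed.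

Lemma sqr_le_dotR (R : realType) (T : finType) (x : T -> R) t :
  x t ^+ 2 <= dotR x x.
Proof.
rewrite /dotR (bigD1 t) //= -expr2 lerDl.
by apply: sumr_ge0 => i _; rewrite -expr2 sqr_ge0.
Qed.

Lemma dotR_cvg (R : realType) (T : finType) (x_ y_ : nat -> T -> R) x y :
  (forall t, (fun n => x_ n t) @ \oo --> x t) ->
  (forall t, (fun n => y_ n t) @ \oo --> y t) ->
  (fun n => dotR (x_ n) (y_ n)) @ \oo --> dotR x y.
Proof.
move=> cx cy; rewrite /dotR.
apply: (@cvg_big _ _ +%R) => [|t _]; first by apply: add_continuous.
exact: cvgM.
Qed.

(** The minimal squared norms [m n] increase and are bounded by [B], so almost minimal points form a
    Cauchy sequence. The limit [z] may lie outside the sets; the last clause is the obtuse-angle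
    property of a nearest point to 0, for [y] in all of them. *)
Lemma nested_convex_cvg (R : realType) (T : finType) (S : nat -> set (T -> R))
    (B : R) :
  (forall n, convexR (S n)) -> (forall n m, (n <= m)%N -> S m `<=` S n) ->
  (forall n, exists2 x, S n x & dotR x x <= B) ->
  exists (x_ : nat -> T -> R) (z : T -> R),
    [/\ forall n, S n (x_ n), forall t, (fun n => x_ n t) @ \oo --> z t &
        forall y, (forall n, S n y) -> dotR z z <= dotR z y].
Proof.
move=> Sconv Smono Sbnd.
pose sq n := [set dotR x x | x in S n].
have lb0 n : lbound (sq n) 0 by move=> _ [x _ <-]; exact: dotR_ge0.
have hl n : has_lbound (sq n) by exists 0; exact: lb0.
have hinf n : has_inf (sq n).
  by split => //; have [x Sx _] := Sbnd n; exists (dotR x x), x.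
pose m n := inf (sq n).
have mle n x : S n x -> m n <= dotR x x.
  by move=> Sx; apply: ge_inf; [exact: hl | exists x].
have mB n : m n <= B.
  by have [x Sx xB] := Sbnd n; apply: le_trans xB; exact: mle.
have mmono n k : (n <= k)%N -> m n <= m k.
  move=> nk; apply: lb_le_inf; first by have [] := hinf k.
  by move=> _ [x Sx <-]; apply: mle; apply: Smono Sx.
have /choice[x_ x_P] : forall n, exists x,
    S n x /\ dotR x x < m n + n.+1%:R^-1.
  move=> n.
  have n0 : 0 < n.+1%:R^-1 :> R by rewrite invr_gt0.
  have [_ [x Sx <-] xlt] := inf_adherent n0 (hinf n).
  by exists x.
have xS n : S n (x_ n) by case: (x_P n).
have xm n : dotR (x_ n) (x_ n) < m n + n.+1%:R^-1 by case: (x_P n).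
pose ms := [set m n | n in setT].
have hs : has_sup ms.
  by split; [exists (m 0%N), 0%N | exists B => _ [n _ <-]; exact: mB].
have mub n : m n <= sup ms by apply: ub_le_sup; [case: hs | exists n].
(* parallelogram law: the midpoint of two almost minimal points of [S n] has
   squared norm at least [m n] *)
have par n k : (n <= k)%N ->
    dotR (fun t => x_ k t - x_ n t) (fun t => x_ k t - x_ n t)
      <= 2 * (m k - m n) + 4 * n.+1%:R^-1.
  move=> nk.
  have half : 0 <= (2^-1 : R) <= 1 by lra.
  have := mle n _ (Sconv n _ _ _ (Smono _ _ nk _ (xS k)) (xS n) half).
  have -> : (fun t => x_ k t - x_ n t) = (fun t => 1 * x_ k t + (-1) * x_ n t).
    by apply/funext => t; ring.
  rewrite !dotR_lin !(dotRC _ _ _ (fun t => _ + _)) !dotR_lin.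
  rewrite (dotRC _ _ (x_ n) (x_ k)).
  have := xm n; have := xm k.
  have kn : (k.+1%:R^-1 : R) <= n.+1%:R^-1.
    by rewrite lef_pV2 ?posrE ?ltr0n// ler_nat ltnS.
  move: (n.+1%:R^-1) (k.+1%:R^-1) kn => a b; lra.
have near_cauchy e : 0 < e -> exists N, forall k, (N <= k)%N ->
    dotR (fun t => x_ k t - x_ N t) (fun t => x_ k t - x_ N t) < e.
  move=> e0.
  (* The tolerances [e / 4] and [e / 8] make each of the two terms in [par] at most [e / 2]. *)
  have [_ [N1 _ <-] hN1] := sup_adherent (divr_gt0 e0 (ltr0Sn R 3)) hs.
  have [N2 hN2] : exists N2, forall n, (N2 <= n)%N -> (n.+1%:R^-1 : R) < e / 8.
    have e8 : 0 < e / 8 by lra.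
    have [N2 _ h] := near_infty_natSinv_lt (PosNum e8).
    by exists N2 => n /h.
  exists (maxn N1 N2) => k Nk.
  apply: le_lt_trans (par _ _ Nk) _.
  have := hN2 _ (leq_maxr N1 N2); have := mmono _ _ (leq_maxl N1 N2).
  have := mub k; move: ((maxn N1 N2).+1%:R^-1) => a; lra.
have cx t : cvgn (fun n => x_ n t).
  apply/cauchy_cvgP/cauchy_exP => e e0.
  have [N hN] := near_cauchy (e ^+ 2) (exprn_gt0 2 e0).
  exists (x_ N t), N => // k Nk /=.
  rewrite /ball /= -(ltr_pXn2r (n := 2)) ?nnegrE ?normr_ge0 ?(ltW e0)//.
  rewrite real_normK ?num_real// -sqrrN opprB.
  by apply: le_lt_trans (hN k Nk); exact: sqr_le_dotR (fun t => x_ k t - x_ N t) t.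
exists x_, (fun t => limn (fun n => x_ n t)); split => // y Sy.
set z := fun t => _.
have cxz t : (fun n => x_ n t) @ \oo --> z t by exact: cx.
have cy t : (fun _ : nat => y t) @ \oo --> y t by exact: cvg_cst.
have czz := dotR_cvg _ _ _ _ _ _ cxz cxz.
have czy := dotR_cvg _ _ _ _ _ _ cxz cy.
have cyy : (fun n => dotR y y) @ \oo --> dotR y y by exact: cvg_cst.
have cinv : (fun n => n.+1%:R^-1 : R) @ \oo --> (0 : R) by exact: cvg_harmonic.
(* First variation: [p * y + (1 - p) * x_ n] lies in [S n], so its squared norm is at least [m n],
   which exceeds that of [x_ n] minus [1/(n+1)]. Expand in [p] and let [n] grow. *)
have step p : 0 <= p <= 1 ->
    0 <= 2 * p * (dotR z y - dotR z z)
         + p ^+ 2 * (dotR y y - 2 * dotR z y + dotR z z).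
  move=> p01.
  have hn n : 0 <= 2 * p * (dotR (x_ n) y - dotR (x_ n) (x_ n))
         + p ^+ 2 * (dotR y y - 2 * dotR (x_ n) y + dotR (x_ n) (x_ n))
         + n.+1%:R^-1.
    have := mle n _ (Sconv n _ _ p (Sy n) (xS n) p01).
    rewrite !dotR_lin !(dotRC _ _ _ (fun t => _ + _)) !dotR_lin.
    rewrite (dotRC _ _ y (x_ n)).
    have := xm n; move: (n.+1%:R^-1) => a; lra.
  have : (fun n => 2 * p * (dotR (x_ n) y - dotR (x_ n) (x_ n))
         + p ^+ 2 * (dotR y y - 2 * dotR (x_ n) y + dotR (x_ n) (x_ n))
         + n.+1%:R^-1) @ \oo --> 2 * p * (dotR z y - dotR z z)
         + p ^+ 2 * (dotR y y - 2 * dotR z y + dotR z z) + 0.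
    apply: cvgD => //; apply: cvgD; apply: cvgM; try exact: cvg_cst.
      exact: cvgB.
    apply: cvgD => //; apply: cvgB => //; apply: cvgM => //; exact: cvg_cst.
  rewrite addr0 => cl; rewrite -(cvg_lim _ cl)//.
  by apply: limr_ge; [apply/cvg_ex; eexists; exact: cl | exact: nearW].
rewrite -subr_ge0 leNgt; apply/negP => neg.
move: step neg; move: (dotR z y - dotR z z) (dotR y y - _ + _) => u w step neg.
have h1 := step 1; have w1 : 0 < w by nra.
(* For this [p] the quadratic term [p ^+ 2 * w] is at most [- p * u], so the whole is at most
   [p * u < 0]. *)
pose p := Order.min 1 (- u / w).
have p0 : 0 < p by rewrite lt_min ltr01 /= divr_gt0 // oppr_gt0.
have pw : p * w <= - u by rewrite -ler_pdivlMr // ge_min lexx orbT.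
have p1 : p <= 1 by rewrite ge_min lexx.
have := step p; nra.
Qed.

Definition dual_cone {R : realType} {T : finType} (G : set (T -> R)) :
  set (T -> R) := [set p | forall g, G g -> 0 <= dotR p g].

Lemma dual_cone_lin (R : realType) (T : finType) (G : set (T -> R)) a b x y :
  0 <= a -> 0 <= b -> dual_cone G x -> dual_cone G y ->
  dual_cone G (fun t => a * x t + b * y t).
Proof.
by move=> a0 b0 Gx Gy g Gg; rewrite dotR_lin addr_ge0 // mulr_ge0 //;
  [exact: Gx | exact: Gy].
Qed.

(** Separation argument. Let [z] be the norm-minimal limit of differences of [K] and the cone. Since
    [G] lies in its own dual cone, one can move arbitrarily far along any [g] in [G], which forces
    [- z] into the dual cone. Testing [K] against [- z] with tolerance [dotR z z / 2] then
    contradicts minimality unless [z] is 0. *)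
Lemma dual_cone_near (R : realType) (T : finType) (K G : set (T -> R)) :
  convexR K -> (forall g h, G g -> G h -> 0 <= dotR g h) ->
  (forall r d, dual_cone G r -> 0 < d -> exists2 x, K x & - d <= dotR x r) ->
  forall e, 0 < e ->
    exists x p, [/\ K x, dual_cone G p & forall t, `|x t - p t| <= e].
Proof.
move=> Kconv Gpos Kr e e0.
pose A : set (T -> R) := [set a | exists x p,
  [/\ K x, dual_cone G p & a = fun t => x t - p t]].
have dual0 : dual_cone G (fun=> 0).
  by move=> g _; rewrite /dotR big1 // => t _; rewrite mul0r.
have Aconv : convexR A.
  move=> _ _ q [x [p [Kx Gp ->]]] [y [r [Ky Gr ->]]] /andP[q0 q1].
  exists (fun t => q * x t + (1 - q) * y t), (fun t => q * p t + (1 - q) * r t).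
  split; first by apply: Kconv => //; rewrite q0.
    by apply: dual_cone_lin => //; rewrite subr_ge0.
  by apply/funext => t; ring.
have [x0 Kx0 _] := Kr _ 1 dual0 ltr01.
have AK x : K x -> A x.
  by move=> Kx; exists x, (fun=> 0); split => //; apply/funext => t; rewrite subr0.
(* The nested family is constant, so membership in all its sets reads [nat -> A y]. *)
have [a_ [z [Aa az zmin]]] : exists (a_ : nat -> T -> R) (z : T -> R),
    [/\ forall n, A (a_ n), forall t, (fun n => a_ n t) @ \oo --> z t &
        forall y, (nat -> A y) -> dotR z z <= dotR z y].
  apply: (nested_convex_cvg R T (fun=> A) (dotR x0 x0)) => [n|n m _ x|n].
  - exact: Aconv.
  - by [].
  - by exists x0 => //; exact: AK.
have zK x p : K x -> dual_cone G p -> dotR z z <= dotR z x - dotR z p.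
  move=> Kx Gp; have -> : dotR z x - dotR z p = dotR z (fun t => x t - p t).
    by rewrite /dotR -sumrB; apply: eq_bigr => t _; rewrite mulrBr.
  by apply: zmin => _; exists x, p.
have zK0 x : K x -> dotR z z <= dotR z x.
  by move=> Kx; apply: zmin => _; exact: AK.
have dualN : dual_cone G (fun t => - z t).
  move=> g Gg; have -> : dotR (fun t => - z t) g = - dotR z g.
    by rewrite /dotR -sumrN; apply: eq_bigr => t _; rewrite mulNr.
  rewrite oppr_ge0 leNgt; apply/negP => c0.
  (* [l * dotR z g] exceeds by 1 the largest value that [zK] allows at [x0]. *)
  pose l := (dotR z x0 - dotR z z + 1) / dotR z g.
  have l0 : 0 <= l by rewrite divr_ge0 ?(ltW c0) //; have := zK0 _ Kx0; lra.
  have Glg : dual_cone G (fun t => l * g t + 0 * g t).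
    by apply: dual_cone_lin => // h Gh; exact: Gpos.
  have := zK _ _ Kx0 Glg.
  rewrite (dotRC _ _ z (fun t => _ + _)) dotR_lin (dotRC _ _ g z) mul0r addr0.
  by rewrite divfK ?gt_eqF //; lra.
have zz0 : dotR z z = 0.
  apply/eqP; rewrite eq_le dotR_ge0 andbT leNgt; apply/negP => zz.
  have [x Kx] := Kr _ _ dualN (divr_gt0 zz (ltr0Sn R 1)).
  have -> : dotR x (fun t => - z t) = - dotR z x.
    by rewrite /dotR -sumrN; apply: eq_bigr => t _; rewrite mulrN mulrC.
  by have := zK0 _ Kx; lra.
have := dotR_cvg _ _ _ _ _ _ az az; rewrite zz0.
move=> /cvgrPdist_lt /(_ _ (exprn_gt0 2 e0)) [n _ /(_ n (leqnn n)) /=].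
rewrite sub0r normrN ger0_norm ?dotR_ge0 // => ae.
have [x [p [Kx Gp ap]]] := Aa n; exists x, p; split => // t.
rewrite -(ler_pXn2r (n := 2)) ?nnegrE ?normr_ge0 ?(ltW e0)//.
rewrite real_normK ?num_real//; apply: le_trans (ltW ae).
by rewrite ap; exact: sqr_le_dotR (fun t => x t - p t) t.
Qed.

(** The points of [K] within [1/(n+1)] of the cone form nested nonempty convex sets, bounded by [B];
    the nested-sets lemma takes the place of extracting a convergent subsequence. The sequence is
    part of the conclusion because its limit may leave [K]. *)
Lemma self_dual_minimax (R : realType) (T : finType) (K G : set (T -> R)) B :
  convexR K -> (forall x, K x -> dotR x x <= B) ->
  (forall g h, G g -> G h -> 0 <= dotR g h) ->
  (forall r d, dual_cone G r -> 0 < d -> exists2 x, K x & - d <= dotR x r) ->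
  exists (x_ : nat -> T -> R) z,
    [/\ forall n, K (x_ n), forall t, (fun n => x_ n t) @ \oo --> z t &
        dual_cone G z].
Proof.
move=> Kconv Kbnd Gpos Kr.
have near := dual_cone_near R T K G Kconv Gpos Kr.
pose S n : set (T -> R) := [set x | K x /\ exists p,
  dual_cone G p /\ forall t, `|x t - p t| <= n.+1%:R^-1].
have Sconv n : convexR (S n).
  move=> x y q [Kx [p [Gp xp]]] [Ky [r [Gr yr]]] /andP[q0 q1]; split.
    by apply: Kconv => //; rewrite q0.
  exists (fun t => q * p t + (1 - q) * r t); split.
    by apply: dual_cone_lin => //; rewrite subr_ge0.
  move=> t.
  have -> : q * x t + (1 - q) * y t - (q * p t + (1 - q) * r t)
    = q * (x t - p t) + (1 - q) * (y t - r t) by ring.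
  apply: le_trans (ler_normD _ _) _; rewrite !normrM ger0_norm //.
  rewrite (ger0_norm (x := 1 - q)) ?subr_ge0 //.
  have q1' : 0 <= 1 - q by rewrite subr_ge0.
  have := ler_wpM2l q0 (xp t); have := ler_wpM2l q1' (yr t).
  by move: (n.+1%:R^-1) => c; lra.
have Smono n m : (n <= m)%N -> S m `<=` S n.
  move=> nm x [Kx [p [Gp xp]]]; split => //; exists p; split => // t.
  by apply: le_trans (xp t) _; rewrite lef_pV2 ?posrE ?ltr0n// ler_nat ltnS.
have [|x_ [z [xS xz _]]] := nested_convex_cvg R T S B Sconv Smono.
  move=> n; have n0 : 0 < n.+1%:R^-1 :> R by rewrite invr_gt0.
  have [x [p [Kx Gp xp]]] := near _ n0.
  by exists x; [split => //; exists p | exact: Kbnd].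
exists x_, z; split => //; first by move=> n; case: (xS n).
move=> g Gg.
pose s := \sum_t `|g t|.
have lo n : 0 <= dotR (x_ n) g + n.+1%:R^-1 * s.
  have [_ [p [Gp xp]]] := xS n.
  apply: le_trans (Gp g Gg) _.
  rewrite /dotR /s mulr_sumr -big_split; apply: ler_sum => t _ /=.
  rewrite -lerBlDl -mulrBl; apply: le_trans (ler_norm _) _.
  by rewrite normrM ler_wpM2r // distrC.
have cg t : (fun _ : nat => g t) @ \oo --> g t by exact: cvg_cst.
have cl : (fun n => dotR (x_ n) g + n.+1%:R^-1 * s) @ \oo --> dotR z g + 0 * s.
  apply: cvgD; first exact: dotR_cvg.
  by apply: cvgM; [exact: cvg_harmonic | exact: cvg_cst].
move: cl; rewrite mul0r addr0 => cl; rewrite -(cvg_lim _ cl)//.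
by apply: limr_ge; [apply/cvg_ex; eexists; exact: cl | exact: nearW].
Qed.

(** * Positive semidefinite matrices over a finite index type *)

Section PositiveSemidefinite.
Context {C : numClosedFieldType}.

Definition sesq {I : finType} (A : I -> I -> C) (u v : I -> C) : C :=
  \sum_s \sum_t (u s)^* * A s t * v t.

Definition psdF {I : finType} (A : I -> I -> C) : Prop :=
  forall v, 0 <= sesq A v v.

Lemma sum_pred1l (I : finType) (i : I) (F : I -> C) :
  \sum_j (j == i)%:R * F j = F i.
Proof.
rewrite (bigD1 i) //= eqxx mul1r big1 ?addr0 // => j /negPf ->.
by rewrite mul0r.
Qed.

Lemma sum_pred1r (I : finType) (i : I) (F : I -> C) :
  \sum_j F j * (j == i)%:R = F i.
Proof. by rewrite -[RHS]sum_pred1l; apply: eq_bigr => j _; rewrite mulrC. Qed.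

Lemma sesq_linl (I : finType) (A : I -> I -> C) a b u u' v :
  sesq A (fun s => a * u s + b * u' s) v
  = a^* * sesq A u v + b^* * sesq A u' v.
Proof.
rewrite /sesq !mulr_sumr -big_split; apply: eq_bigr => s _ /=.
rewrite !mulr_sumr -big_split; apply: eq_bigr => t _ /=.
by rewrite rmorphD !rmorphM /=; ring.
Qed.

Lemma sesq_linr (I : finType) (A : I -> I -> C) a b u v v' :
  sesq A u (fun s => a * v s + b * v' s)
  = a * sesq A u v + b * sesq A u v'.
Proof.
rewrite /sesq !mulr_sumr -big_split; apply: eq_bigr => s _ /=.
by rewrite !mulr_sumr -big_split; apply: eq_bigr => t _ /=; ring.
Qed.

Lemma sesq_deltal (I : finType) (A : I -> I -> C) s v :
  sesq A (fun i => (i == s)%:R) v = \sum_t A s t * v t.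
Proof.
rewrite -[RHS](sum_pred1l _ s (fun s => \sum_t A s t * v t)).
apply: eq_bigr => i _; rewrite conjC_nat mulr_sumr.
by apply: eq_bigr => t _; rewrite mulrA.
Qed.

Lemma sesq_deltar (I : finType) (A : I -> I -> C) u t :
  sesq A u (fun i => (i == t)%:R) = \sum_s (u s)^* * A s t.
Proof. by apply: eq_bigr => s _; rewrite sum_pred1r. Qed.

Lemma sesq_delta (I : finType) (A : I -> I -> C) s t :
  sesq A (fun i => (i == s)%:R) (fun i => (i == t)%:R) = A s t.
Proof. by rewrite sesq_deltal sum_pred1r. Qed.

Lemma psdF_diag (I : finType) (A : I -> I -> C) s : psdF A -> 0 <= A s s.
Proof. by move=> pA; rewrite -(sesq_delta _ A); exact: pA. Qed.

Lemma psdF_pair (I : finType) (A : I -> I -> C) s t a b : psdF A ->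
  0 <= a^* * a * A s s + a^* * b * A s t + b^* * a * A t s + b^* * b * A t t.
Proof.
move=> /(_ (fun i => a * (i == s)%:R + b * (i == t)%:R)).
rewrite sesq_linl !sesq_linr !sesq_delta.
by congr (0 <= _); ring.
Qed.

(** A nonnegative complex number is real. The vectors [e_s + e_t] and [e_s + 'i e_t] show that
    [A s t + A t s] and ['i (A s t - A t s)] are real, which together determine [A t s]. *)
Lemma psdF_herm (I : finType) (A : I -> I -> C) : psdF A ->
  forall s t, A t s = (A s t)^*.
Proof.
move=> pA s t.
have ds := psdF_diag _ _ s pA; have dt := psdF_diag _ _ t pA.
have rs : A s s \is Num.real by exact: ger0_real.
have rt : A t t \is Num.real by exact: ger0_real.
have h1 : 0 <= A s s + A s t + A t s + A t t.
  by have := psdF_pair _ _ s t 1 1 pA; rewrite conjC1 !mul1r.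
have h2 : 0 <= A s s + 'i * A s t - 'i * A t s + A t t.
  have := psdF_pair _ _ s t 1 'i pA; rewrite conjC1 conjCi !mul1r !mulr1.
  by rewrite (_ : - 'i * 'i = 1) ?mul1r ?mulNr // -expr2 sqrCi opprK.
have /CrealP := ger0_real h2; have /CrealP := ger0_real h1.
rewrite !rmorphD rmorphN !rmorphM /= (CrealP rs) (CrealP rt) conjCi => e1 e2.
have e1' : (A s t)^* + (A t s)^* = A s t + A t s.
  apply: (addrI (A s s)); apply: (addIr (A t t)).
  by rewrite !addrA.
have e2' : - 'i * (A s t)^* + 'i * (A t s)^* = 'i * A s t - 'i * A t s.
  apply: (addrI (A s s)); apply: (addIr (A t t)).
  by rewrite !addrA -[RHS]e2 !mulNr opprK.
have e3 : (A t s)^* - (A s t)^* = A s t - A t s.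
  by apply: (mulfI (neq0Ci C)); rewrite !mulrBr -[RHS]e2' addrC mulNr.
have : 2 * A t s = 2 * (A s t)^*.
  have -> : 2 * A t s = (A s t + A t s) - (A s t - A t s) by ring.
  by rewrite -e1' -e3; ring.
by apply: mulfI; rewrite pnatr_eq0.
Qed.

Lemma psdF_diag0 (I : finType) (A : I -> I -> C) s t : psdF A ->
  A s s = 0 -> A s t = 0.
Proof.
move=> pA s0; apply/eqP; apply/negPn/negP => z0.
pose z := A s t; pose n := z * z^*.
have n0 : 0 < n by rewrite /n -normCK exprn_gt0 // normr_gt0.
have t0 := psdF_diag _ _ t pA.
(* At the vector [- l z e_s + e_t] the form is [A t t - 2 l n]; this [l] makes it [- A t t - 2],
   which is negative. *)
pose l := (A t t + 1) / n.
have l0 : 0 <= l by rewrite divr_ge0 ?(ltW n0) // addr_ge0.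
have := psdF_pair _ _ s t (- (l * z)) 1 pA.
rewrite s0 mulr0 add0r conjC1 !mul1r !mulr1 (psdF_herm _ _ pA s t) -/z.
rewrite rmorphN rmorphM /= (CrealP (ger0_real l0)) => h.
have ln : l * n = A t t + 1 by rewrite /l divfK // gt_eqF.
have : 0 <= - (A t t + 1) - 1.
  suff -> : - (A t t + 1) - 1 = - (l * z^*) * z + - (l * z) * z^* + A t t by [].
  have -> : A t t = l * n - 1 by rewrite ln addrK.
  by rewrite /n; ring.
by rewrite -opprD oppr_ge0 lt_geF // (lt_le_trans ltr01) // lerDr addr_ge0.
Qed.

(* Cholesky: subtracting the rank-one matrix built from a column with nonzero
   diagonal entry leaves a positive matrix with fewer nonzero diagonal entries. *)
Lemma psdF_gram (I : finType) (A : I -> I -> C) : psdF A ->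
  exists rs : seq (I -> C), forall s t, A s t = \sum_(r <- rs) r s * (r t)^*.
Proof.
have [n] := ubnP #|[pred s | A s s != 0]|.
elim: n A => // n IH A; rewrite ltnS => An pA.
have hA := psdF_herm _ _ pA.
have [/existsP[s0 a0]|/existsPn z] := boolP [exists s, A s s != 0]; last first.
  exists [::] => s t; rewrite big_nil; apply: psdF_diag0 => //.
  by apply/eqP/negPn/z.
pose a := A s0 s0; have age : 0 <= a by exact: psdF_diag.
have areal : a^* = a by apply/CrealP/ger0_real.
pose r s := A s s0 / sqrtC a.
have rr s t : r s * (r t)^* = A s s0 * A s0 t / a.
  rewrite /r rmorphM fmorphV /= -(hA t s0).
  have -> : (sqrtC a)^* = sqrtC a by apply/CrealP/ger0_real; rewrite sqrtC_ge0.
  by rewrite mulrACA -invfM -expr2 sqrtCK.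
pose A' s t := A s t - r s * (r t)^*.
have pA' : psdF A'.
  move=> v; pose c := \sum_t A s0 t * v t.
  have := pA (fun i => 1 * v i + (- (c / a)) * (i == s0)%:R).
  rewrite sesq_linl !sesq_linr sesq_delta sesq_deltal sesq_deltar -/c.
  have -> : \sum_s (v s)^* * A s s0 = c^*.
    rewrite rmorph_sum; apply: eq_bigr => s _ /=.
    by rewrite rmorphM /= -hA mulrC.
  have -> : sesq A' v v = sesq A v v - c^* * c / a.
    rewrite /sesq /c rmorph_sum /= -mulrA mulr_suml -sumrB.
    apply: eq_bigr => s _; rewrite mulr_suml mulr_sumr -sumrB.
    apply: eq_bigr => t _; rewrite rmorphM /= -hA /A' rr; ring.
  rewrite conjC1 rmorphN rmorphM fmorphV /= areal -/a => h.
  by move: h; congr (0 <= _); field.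
have [|rs rsE] := IH A' _ pA'; last first.
  exists (r :: rs) => s t; rewrite big_cons -rsE /A'; ring.
apply: leq_trans An; apply: proper_card; apply/properP; split.
  apply/fintype.subsetP => s; rewrite !inE; apply: contra_neq => s0'.
  by rewrite /A' rr (psdF_diag0 _ _ s s0 pA s0') mul0r mul0r subr0.
exists s0; first by rewrite inE.
by rewrite inE negbK /A' rr -/a mulfK // subrr.
Qed.

(** Schur product theorem: a Gram decomposition of [A] writes the entrywise product as a sum of
    congruences of [B] by diagonal matrices. *)
Lemma psdF_schur (I : finType) (A B : I -> I -> C) : psdF A -> psdF B ->
  psdF (fun s t => A s t * B s t).
Proof.
move=> /psdF_gram[rs rsE] pB v.
have -> : sesq (fun s t => A s t * B s t) v v
    = \sum_(r <- rs) sesq B (fun s => (r s)^* * v s) (fun s => (r s)^* * v s).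
  rewrite /sesq [RHS]exchange_big /=; apply: eq_bigr => s _.
  rewrite [RHS]exchange_big /=; apply: eq_bigr => t _.
  rewrite rsE mulr_suml mulr_sumr mulr_suml; apply: eq_bigr => r _.
  by rewrite rmorphM /= conjCK; ring.
by apply: sumr_ge0 => r _; exact: pB.
Qed.

Lemma psdF_tr (I : finType) (A : I -> I -> C) : psdF A -> psdF (fun s t => A t s).
Proof.
move=> pA v; have := pA (fun s => (v s)^*); congr (0 <= _).
rewrite /sesq exchange_big; apply: eq_bigr => s _; apply: eq_bigr => t _ /=.
by rewrite conjCK; ring.
Qed.

(** The trace of the product is the quadratic form of the Schur product of [A] and the transpose of
    [B] at the all-ones vector. *)
Lemma psdF_trace_mul (I : finType) (A B : I -> I -> C) : psdF A -> psdF B ->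
  0 <= \sum_s \sum_t A s t * B t s.
Proof.
move=> pA /psdF_tr pB; have := psdF_schur _ _ _ pA pB (fun=> 1).
congr (0 <= _); apply: eq_bigr => s _; apply: eq_bigr => t _ /=.
by rewrite conjC1 mul1r mulr1.
Qed.

(** The vector [v] is pushed forward along [f] by summing over fibres. With [f] arbitrary this
    covers principal submatrices as well as repeated indices. *)
Lemma psdF_comp (I J : finType) (f : J -> I) (A : I -> I -> C) : psdF A ->
  psdF (fun s t => A (f s) (f t)).
Proof.
move=> pA v; have := pA (fun i => \sum_(s | f s == i) v s); congr (0 <= _).
rewrite /sesq [RHS](partition_big f predT) //=; apply: eq_bigr => i _.
rewrite [RHS]exchange_big /= [RHS](partition_big f predT) //=.
apply: eq_bigr => j _; rewrite mulr_sumr; apply: eq_bigr => t /eqP <-.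
by rewrite rmorph_sum !mulr_suml; apply: eq_bigr => s /eqP <-.
Qed.

Lemma psdF_sum (I J : finType) (A : J -> I -> I -> C) :
  (forall j, psdF (A j)) -> psdF (fun s t => \sum_j A j s t).
Proof.
move=> pA v; have -> : sesq (fun s t => \sum_j A j s t) v v
    = \sum_j sesq (A j) v v.
  rewrite /sesq [RHS]exchange_big; apply: eq_bigr => s _ /=.
  rewrite [RHS]exchange_big; apply: eq_bigr => t _ /=.
  by rewrite mulr_sumr mulr_suml.
by apply: sumr_ge0 => j _; exact: pA.
Qed.

Lemma psdF_rank1 (I : finType) (w : I -> C) : psdF (fun s t => w s * (w t)^*).
Proof.
move=> v; have -> : sesq (fun s t => w s * (w t)^*) v v
    = (\sum_s (v s)^* * w s) * (\sum_s (v s)^* * w s)^*.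
  rewrite /sesq mulr_suml; apply: eq_bigr => s _.
  rewrite rmorph_sum mulr_sumr; apply: eq_bigr => t _ /=.
  by rewrite rmorphM /= conjCK; ring.
by rewrite -normCK exprn_ge0.
Qed.

(** With [c] the inner product of [w] and [v], the form is the squared norm of [v - c w], the part
    of [v] orthogonal to [w]. *)
Lemma psdF_id_sub_rank1 (I : finType) (w : I -> C) :
  \sum_s w s * (w s)^* = 1 -> psdF (fun s t => (s == t)%:R - w s * (w t)^*).
Proof.
move=> ww v; have [c cE] : exists c, c = \sum_s (w s)^* * v s by eexists.
have -> : sesq (fun s t => (s == t)%:R - w s * (w t)^*) v v
    = \sum_s (v s - c * w s) * (v s - c * w s)^*.
  transitivity (\sum_s (v s)^* * v s - c^* * c).
    rewrite {1}cE rmorph_sum mulr_suml -sumrB; apply: eq_bigr => s _ /=.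
    transitivity (\sum_t ((t == s)%:R * ((v s)^* * v t) -
        (v s)^* * w s * ((w t)^* * v t))).
      by apply: eq_bigr => t _; rewrite eq_sym; ring.
    by rewrite sumrB sum_pred1l -mulr_sumr -cE rmorphM /= conjCK (mulrC (w s)).
  transitivity (\sum_s (v s)^* * v s - c^* * (\sum_s (w s)^* * v s)
      - c * (\sum_s (w s)^* * v s)^* + c * c^* * (\sum_s w s * (w s)^*)).
    by rewrite ww -cE; ring.
  rewrite rmorph_sum !mulr_sumr -!sumrB -big_split /=; apply: eq_bigr => s _.
  by rewrite rmorphB !rmorphM /= conjCK; ring.
by apply: sumr_ge0 => s _; rewrite -normCK exprn_ge0.
Qed.

End PositiveSemidefinite.

(** * Basis states of composite systems *)

Definition mkst (X : {fset nat}) (f : nat -> bool) : st X :=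
  [ffun x : X => f (val x)].

(** Identifies the basis of [H_X] with pairs of basis states of [W] and of its complement in [X]. *)
Definition glue {W X : {fset nat}} (w : st W) (z : st (X `\` W)%fset) : st X :=
  mkst X (fun q => if q \in W then val_at W w q else val_at (X `\` W)%fset z q).

Lemma val_atE (X : {fset nat}) (s : st X) (x : X) : val_at X s (val x) = s x.
Proof. by rewrite /val_at valK. Qed.

Lemma st_ext (X : {fset nat}) (s t : st X) :
  (forall q, q \in X -> val_at X s q = val_at X t q) -> s = t.
Proof. by move=> e; apply/ffunP => x; rewrite -!val_atE; apply/e/valP. Qed.

Lemma val_at_mkst (X : {fset nat}) f q : q \in X -> val_at X (mkst X f) q = f q.
Proof. by move=> qX; rewrite -[q]/(val [` qX]%fset) val_atE ffunE. Qed.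

Lemma val_at_restr (V X : {fset nat}) (s : st X) q :
  q \in V -> val_at V (restr V X s) q = val_at X s q.
Proof. exact: val_at_mkst. Qed.

Lemma val_at_merge (V X : {fset nat}) a s q : q \in X ->
  val_at X (merge V X a s) q
  = if q \in V then val_at V a q else val_at X s q.
Proof.
move=> qX; have -> : merge V X a s
    = mkst X (fun q => if q \in V then val_at V a q else val_at X s q).
  by apply/ffunP => x; rewrite !ffunE val_atE.
exact: val_at_mkst.
Qed.

Lemma val_at_glue (W X : {fset nat}) (w : st W) (z : st (X `\` W)%fset) q :
  q \in X -> val_at X (glue w z) q
  = if q \in W then val_at W w q else val_at (X `\` W)%fset z q.
Proof. exact: val_at_mkst. Qed.

Lemma agree_offE (V X : {fset nat}) s t :
  agree_off V X s t
  = (restr (X `\` V)%fset X s == restr (X `\` V)%fset X t).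
Proof.
apply/forallP/eqP => [st|e x].
  apply: st_ext => q qXV; rewrite !val_at_restr //.
  move: qXV; rewrite inE => /andP[qV qX].
  have /implyP/(_ qV)/eqP := st [` qX]%fset.
  by rewrite -!val_atE.
apply/implyP => xV; apply/eqP; rewrite -!val_atE.
have xXV : val x \in (X `\` V)%fset by rewrite inE xV /=; exact: valP.
have := congr1 (fun u => val_at (X `\` V)%fset u (val x)) e.
by rewrite !val_at_restr.
Qed.

Lemma restr_id (V : {fset nat}) (s : st V) : restr V V s = s.
Proof. by apply: st_ext => q qV; rewrite val_at_restr. Qed.

Lemma merge_id (V : {fset nat}) (a s : st V) : merge V V a s = a.
Proof. by apply: st_ext => q qV; rewrite val_at_merge // qV. Qed.

Section Glue.
Context {V W X : {fset nat}}.
Hypotheses (VW : fsubset V W) (WX : fsubset W X).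
Implicit Types (w : st W) (z : st (X `\` W)%fset).

Lemma restr_glue w z : restr V X (glue w z) = restr V W w.
Proof.
apply: st_ext => q qV; have qW := fsubsetP VW _ qV.
by rewrite !val_at_restr // val_at_glue ?qW // (fsubsetP WX).
Qed.

Lemma restr_glueC w z : restr (X `\` W)%fset X (glue w z) = z.
Proof.
apply: st_ext => q qXW; rewrite val_at_restr //.
by move: (qXW); rewrite inE => /andP[/negPf qW qX]; rewrite val_at_glue // qW.
Qed.

Lemma merge_glue a w z :
  merge V X a (glue w z) = glue (merge V W a w) z.
Proof.
apply: st_ext => q qX; rewrite val_at_merge // !val_at_glue //.
case: ifP => qV; first by rewrite (fsubsetP VW _ qV) val_at_merge ?qV // (fsubsetP VW).
by case: ifP => qW //; rewrite val_at_merge // qV.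
Qed.

Lemma glue_restr (s : st X) :
  glue (restr W X s) (restr (X `\` W)%fset X s) = s.
Proof.
apply: st_ext => q qX; rewrite val_at_glue //.
by case: ifP => qW; rewrite val_at_restr // inE qW.
Qed.

End Glue.

Lemma sum_glue (C : nmodType) (W X : {fset nat}) (F : st X -> C) :
  fsubset W X -> \sum_s F s = \sum_w \sum_z F (@glue W X w z).
Proof.
move=> WX; rewrite pair_big /=.
apply: (reindex (fun p : st W * st (X `\` W)%fset => glue p.1 p.2)).
exists (fun s => (restr W X s, restr (X `\` W)%fset X s)) => [[w z] _|s _] /=.
  by rewrite (restr_glue (fsubset_refl W) WX) restr_id restr_glueC.
exact: glue_restr.
Qed.

(** * Partial trace, adjoints and Choi matrices *)

Section Operators.
Context {R : realType}.
Notation C := R[i].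

(** The partial trace over the variables of [X] outside [W]. *)
Definition ptr (W X : {fset nat}) (rho : @Op R X) : @Op R W :=
  fun w w' => \sum_z rho (@glue W X w z) (glue w' z).

Lemma psdP (X : {fset nat}) (A : @Op R X) : psd X A <-> psdF A.
Proof. by []. Qed.

Lemma trO_ptr (W X : {fset nat}) (rho : @Op R X) : fsubset W X ->
  trO X rho = trO W (ptr W X rho).
Proof. by move=> WX; rewrite /trO (sum_glue _ _ _ _ WX). Qed.

Lemma psd_ptr (W X : {fset nat}) (rho : @Op R X) :
  psd X rho -> psd W (ptr W X rho).
Proof.
move=> /psdP pr; apply/psdP/psdF_sum => z.
exact: (psdF_comp _ _ (fun w => glue w z) _ pr).
Qed.

(** An observable on [W] sees only the reduced state: the identity factor kills all terms whose
    outer indices differ. *)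
Lemma tr_ext (W X : {fset nat}) (M : @Op R W) (rho : @Op R X) : fsubset W X ->
  trO X (mulO X (ext W X M) rho) = trO W (mulO W M (ptr W X rho)).
Proof.
move=> WX; rewrite /trO /mulO (sum_glue _ _ _ _ WX).
apply: eq_bigr => w _.
rewrite exchange_big /= (sum_glue _ _ _ _ WX); apply: eq_bigr => w' _.
rewrite exchange_big /= mulr_sumr; apply: eq_bigr => z _.
rewrite (bigD1 z) //= big1 ?addr0 => [|z' /negPf zz'].
  rewrite /ext agree_offE !restr_glueC eqxx.
  by rewrite !(restr_glue (fsubset_refl W) WX) !restr_id.
by rewrite /ext agree_offE !restr_glueC eq_sym zz' mul0r.
Qed.

Lemma linearS_sum (V : {fset nat}) (E : @Op R V -> @Op R V) (J : Type)
    (r : seq J) (c : J -> C) (A : J -> @Op R V) : linearS V E ->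
  E (fun s t => \sum_(j <- r) c j * A j s t)
  = (fun s t => \sum_(j <- r) c j * E (A j) s t).
Proof.
move=> lE; elim: r => [|j r IH].
  (* Linearity with scalar [-1] at zero gives [E 0 = - E 0 + E 0 = 0]. *)
  have := lE (-1) (fun _ _ => 0) (fun _ _ => 0).
  rewrite (_ : (fun s t => -1 * 0 + 0) = (fun _ _ => 0)); last first.
    by apply/funext => s; apply/funext => t; rewrite mulr0 addr0.
  rewrite (_ : (fun s t => \sum_(j <- [::]) _) = (fun _ _ => 0)); last first.
    by apply/funext => s; apply/funext => t; rewrite big_nil.
  move=> e; apply/funext => s; apply/funext => t.
  rewrite big_nil.
  have := congr1 (fun f => f s t) e => /=.
  by rewrite mulN1r addNr.
transitivity (E (fun s t => c j * A j s t + \sum_(j <- r) c j * A j s t)).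
  by congr E; apply/funext => s; apply/funext => t; rewrite big_cons.
rewrite lE IH; apply/funext => s; apply/funext => t.
by rewrite big_cons.
Qed.

Lemma linearS_unit (V : {fset nat}) (E : @Op R V -> @Op R V) (A : @Op R V) s t :
  linearS V E ->
  E A s t = \sum_(p : st V * st V) A p.1 p.2 * E (unitO V p.1 p.2) s t.
Proof.
move=> lE.
have {1}-> : A = fun s t => \sum_p A p.1 p.2 * unitO V p.1 p.2 s t.
  apply/funext => a; apply/funext => b; rewrite (bigD1 (a, b)) //=.
  rewrite /unitO !eqxx mulr1 big1 ?addr0 // => -[a' b'].
  by rewrite xpair_eqE eq_sym (eq_sym b') /= => /negPf ->; rewrite mulr0.
by rewrite linearS_sum.
Qed.

Lemma linearS_extS (V X : {fset nat}) (E : @Op R V -> @Op R V) :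
  linearS V E -> linearS X (extS V X E).
Proof.
move=> lE a A B; apply/funext => s; apply/funext => t.
by rewrite /extS lE.
Qed.

Lemma ptr_extS (V W X : {fset nat}) (E : @Op R V -> @Op R V) (rho : @Op R X) :
  linearS V E -> fsubset V W -> fsubset W X ->
  ptr W X (extS V X E rho) = extS V W E (ptr W X rho).
Proof.
move=> lE VW WX; apply/funext => w; apply/funext => w'.
rewrite /ptr /extS.
transitivity (E (fun a b => \sum_z 1 *
    rho (@glue W X (merge V W a w) z) (glue (merge V W b w') z))
    (restr V W w) (restr V W w')).
  rewrite linearS_sum //; apply: eq_bigr => z _; rewrite mul1r.
  rewrite !(restr_glue VW WX); congr (E _ _ _).
  by apply/funext => a; apply/funext => b; rewrite !merge_glue.
congr (E _ _ _); apply/funext => a; apply/funext => b.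
by apply: eq_bigr => z _; rewrite mul1r.
Qed.

Lemma trO_mulC (X : {fset nat}) (A B : @Op R X) :
  trO X (mulO X A B) = trO X (mulO X B A).
Proof.
rewrite /trO /mulO exchange_big; apply: eq_bigr => s _; apply: eq_bigr => t _ /=.
by rewrite mulrC.
Qed.

Lemma tr_adjS (X : {fset nat}) (F : @Op R X -> @Op R X) N sigma : linearS X F ->
  trO X (mulO X (adjS X F N) sigma) = trO X (mulO X N (F sigma)).
Proof.
move=> lF; rewrite [RHS]trO_mulC.
transitivity (\sum_t \sum_s \sum_a \sum_b
    sigma s t * F (unitO X s t) a b * N b a).
  apply: eq_bigr => t _; apply: eq_bigr => s _.
  rewrite /adjS /trO /mulO mulr_suml; apply: eq_bigr => a _.
  by rewrite mulr_suml; apply: eq_bigr => b _; ring.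
rewrite exchange_big pair_big /= exchange_big /=; apply: eq_bigr => a _.
rewrite exchange_big /=; apply: eq_bigr => b _.
by rewrite (linearS_unit _ _ sigma) // mulr_suml.
Qed.

Lemma tr_ext_adjS (V W X : {fset nat}) (E : @Op R V -> @Op R V) N rho :
  linearS V E -> fsubset V W -> fsubset W X ->
  trO X (mulO X (ext W X (adjS W (extS V W E) N)) rho)
  = trO X (mulO X (ext W X N) (extS V X E rho)).
Proof.
move=> lE VW WX; rewrite !tr_ext // ptr_extS // tr_adjS //.
exact: linearS_extS.
Qed.

Lemma trO_mul_ge0 (X : {fset nat}) (A B : @Op R X) : psd X A -> psd X B ->
  0 <= trO X (mulO X A B).
Proof. exact: psdF_trace_mul. Qed.

Lemma psd_idOp (X : {fset nat}) : psd X (@idOp R X).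
Proof.
apply/psdP; have -> : @idOp R X = fun s t => \sum_k (s == k)%:R * (t == k)%:R^*.
  apply/funext => s; apply/funext => t.
  rewrite (bigD1 s) //= eqxx mul1r conjC_nat eq_sym big1 ?addr0 // => k.
  by rewrite eq_sym => /negPf ->; rewrite mul0r.
by apply: psdF_sum => k; exact: psdF_rank1.
Qed.

(** The extension is the entrywise product of [N] and an identity matrix, both pulled back to the
    states of [X]. *)
Lemma psd_ext (W X : {fset nat}) (N : @Op R W) : psd W N -> psd X (ext W X N).
Proof.
move=> pN; apply/psdP.
have -> : ext W X N = fun s t =>
    idOp (X `\` W)%fset (restr (X `\` W)%fset X s) (restr (X `\` W)%fset X t)
    * N (restr W X s) (restr W X t).
  apply/funext => s; apply/funext => t; rewrite /ext agree_offE /idOp.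
  by case: eqP => _; rewrite ?mul1r ?mul0r.
apply: psdF_schur; first exact: (psdF_comp _ _ _ _ (psd_idOp _)).
exact: psdF_comp.
Qed.

Lemma trace_nonincr_extS (V X : {fset nat}) (E : @Op R V -> @Op R V) rho :
  DProg V E -> fsubset V X -> psd X rho ->
  trO X (extS V X E rho) <= trO X rho.
Proof.
move=> [lE [_ tE]] VX pr; rewrite !(trO_ptr _ _ _ VX).
rewrite ptr_extS ?fsubset_refl //.
have -> : extS V V E (ptr V X rho) = E (ptr V X rho).
  apply/funext => s; apply/funext => t; rewrite /extS !restr_id.
  by congr (E _ _ _); apply/funext => a; apply/funext => b; rewrite !merge_id.
by apply: tE; exact: psd_ptr.
Qed.

Lemma trO_mulO_sub (X : {fset nat}) (A B : @Op R X) :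
  trO X (mulO X (subO X (idOp X) A) B) = trO X B - trO X (mulO X A B).
Proof.
rewrite /trO -sumrB; apply: eq_bigr => s _.
rewrite -(sum_pred1l _ s (fun t => B t s)) /mulO -sumrB; apply: eq_bigr => t _.
by rewrite /subO mulrBl /idOp eq_sym.
Qed.

(** The form of an operator at [v] is its trace against the rank-one state of [v]. Moving [E] onto
    that state, complete positivity gives the lower bound and trace non-increase the upper one. *)
Lemma effect_adjS (V W : {fset nat}) (E : @Op R V -> @Op R V) N :
  DProg V E -> fsubset V W -> effect W N ->
  effect W (adjS W (extS V W E) N).
Proof.
move=> DE VW [pN pN']; have [lE [cE _]] := DE.
pose rk v : @Op R W := fun s t => v s * (v t)^*.
have prk v : psd W (rk v) by exact: psdF_rank1.
have sesqE A v : sesq A v v = trO W (mulO W A (rk v)).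
  apply: eq_bigr => s _; apply: eq_bigr => t _; rewrite /rk; ring.
have lW := linearS_extS _ W _ lE.
have pE v : psd W (extS V W E (rk v)) by exact: cE.
split; apply/psdP => v; rewrite sesqE.
  by rewrite tr_adjS //; apply: trO_mul_ge0.
rewrite trO_mulO_sub tr_adjS //.
have := trO_mul_ge0 _ _ _ pN' (pE v); rewrite trO_mulO_sub !subr_ge0.
by move=> h; apply: le_trans h _; exact: trace_nonincr_extS.
Qed.

Lemma effect_compl (W : {fset nat}) (M : @Op R W) :
  effect W M -> effect W (subO W (idOp W) M).
Proof.
move=> [pM pM']; split => //.
have -> // : subO W (idOp W) (subO W (idOp W) M) = M.
by apply/funext => s; apply/funext => t; rewrite /subO subKr.
Qed.

(** An index is a pair of an input and an output basis state. *)
Definition choi (V : {fset nat}) (E : @Op R V -> @Op R V)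
  (p q : st V * st V) : C := E (unitO V p.1 q.1) p.2 q.2.

(** Choi's criterion without Kraus operators. On pairs [(s, a)] take the Schur product of [rho]
    pulled back along [f] and the Choi matrix pulled back along [g]; its form at a vector depending
    on [s] alone sums over [a] and is the form of the extended image of [rho]. *)
Lemma psd_extS_choi (V X : {fset nat}) (D : @Op R V -> @Op R V) rho :
  linearS V D -> psdF (choi V D) -> psd X rho -> psd X (extS V X D rho).
Proof.
move=> lD pD pr; apply/psdP => v.
pose f (p : st X * st V) := merge V X p.2 p.1.
pose g (p : st X * st V) := (p.2, restr V X p.1).
have := psdF_schur _ _ _ (psdF_comp _ _ f _ pr) (psdF_comp _ _ g _ pD)
  (fun p => v p.1).
congr (0 <= _); rewrite /sesq /f /g /choi /=.
rewrite -(pair_bigA _ (fun s a => \sum_(q : st X * st V) (v s)^* *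
   (rho (merge V X a s) (merge V X q.2 q.1) *
    D (unitO V a q.2) (restr V X s) (restr V X q.1)) * v q.1)) /=.
apply: eq_bigr => s _.
rewrite exchange_big -(pair_bigA _ (fun t b => \sum_a (v s)^* *
   (rho (merge V X a s) (merge V X b t) *
    D (unitO V a b) (restr V X s) (restr V X t)) * v t)) /=.
apply: eq_bigr => t _.
rewrite /extS linearS_unit // mulr_sumr mulr_suml exchange_big pair_big /=.
by apply: eq_bigr => -[a b] _.
Qed.

End Operators.

(** * The pairing of [V] with [V'], and the Choi matrix inside [E^dagger(Omega)] *)

Lemma partner_mem (V V' : {fset nat}) q : #|` V'|%fset = #|` V|%fset ->
  q \in V -> partner V V' q \in V'.
Proof.
move=> cV qV; rewrite /partner -(mem_sort leq) mem_nth // size_sort.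
by rewrite -/(#|` V'|)%fset cV -(size_sort leq) index_mem mem_sort.
Qed.

Lemma partnerK (V V' : {fset nat}) q : #|` V'|%fset = #|` V|%fset ->
  q \in V -> partner V' V (partner V V' q) = q.
Proof.
move=> cV qV; rewrite /partner index_uniq ?nth_index ?mem_sort //.
  by rewrite size_sort -/(#|` V'|)%fset cV -(size_sort leq) index_mem mem_sort.
by rewrite sort_uniq fset_uniq.
Qed.

Lemma card_st (X : {fset nat}) : #|{: st X}| = (2 ^ #|` X|)%N.
Proof. by rewrite card_ffun card_bool cardfE. Qed.

Section Pairing.
Context {R : realType} {V V' : {fset nat}}.
Hypotheses (cV : #|` V'|%fset = #|` V|%fset) (dV : (V `&` V')%fset = fset0).
Notation C := R[i].
Notation W := (V `|` V')%fset.
Notation d := ((2 ^ #|` V|)%N%:R : C).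

(** The [V'] half is relabelled by [V] through [partner], so that basis states of [W] become Choi
    indices. *)
Definition pairst (p : st V * st V) : st W :=
  mkst W (fun q => if q \in V then val_at V p.1 q
                   else val_at V p.2 (partner V' V q)).

Definition unpairst (s : st W) : st V * st V :=
  (restr V W s, mkst V (fun q => val_at W s (partner V V' q))).

Lemma val_at_pairst1 p q : q \in V -> val_at W (pairst p) q = val_at V p.1 q.
Proof. by move=> qV; rewrite val_at_mkst ?inE qV. Qed.

Lemma val_at_pairst2 p q :
  q \in V -> val_at W (pairst p) (partner V V' q) = val_at V p.2 q.
Proof.
move=> qV; have qV' := partner_mem _ _ _ cV qV.
rewrite val_at_mkst ?inE ?qV' ?orbT // partnerK //.
case: ifP => // qVV; have : partner V V' q \in (V `&` V')%fset by rewrite inE qVV.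
by rewrite dV.
Qed.

Lemma pairstK : cancel pairst unpairst.
Proof.
move=> [a b]; congr pair; apply: st_ext => q qV.
  by rewrite val_at_restr // val_at_pairst1.
by rewrite val_at_mkst // val_at_pairst2.
Qed.

Lemma unpairstK : cancel unpairst pairst.
Proof.
move=> s; apply: st_ext => q qW; rewrite val_at_mkst //.
case: ifP => qV; first by rewrite val_at_restr.
have qV' : q \in V' by move: qW; rewrite inE qV.
by rewrite val_at_mkst ?partnerK ?(partner_mem V' V).
Qed.

Lemma merge_pairst x p : merge V W x (pairst p) = pairst (x, p.2).
Proof.
apply: st_ext => q qW; rewrite val_at_merge // !val_at_mkst //.
by case: (q \in V).
Qed.

Lemma restr_pairst p : restr V W (pairst p) = p.1.
Proof. by apply: st_ext => q qV; rewrite val_at_restr // val_at_pairst1. Qed.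

Lemma pairst_inj : injective pairst.
Proof. exact: can_inj pairstK. Qed.

Lemma sum_pairst (F : st W -> C) : \sum_s F s = \sum_p F (pairst p).
Proof.
by apply: (reindex pairst); exists unpairst => x _; [exact: pairstK | exact: unpairstK].
Qed.

Definition omega_vec (s : st W) : C :=
  ((unpairst s).1 == (unpairst s).2)%:R * sqrtC d^-1.

Lemma d_gt0 : 0 < d.
Proof. by rewrite ltr0n expn_gt0. Qed.

Lemma OmegaE : Omega V V' = fun s t => omega_vec s * (omega_vec t)^*.
Proof.
have mE s : [forall v : V, val_at W s (val v) == val_at W s (partner V V' (val v))]
    = ((unpairst s).1 == (unpairst s).2).
  apply/forallP/eqP => [m|e v].
    apply: st_ext => q qV; rewrite val_at_restr // val_at_mkst //.
    by have /eqP := m [` qV]%fset.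
  have := congr1 (fun u => val_at V u (val v)) e.
  by rewrite /= val_at_restr ?val_at_mkst ?(valP v) // => ->.
apply/funext => s; apply/funext => t; rewrite /Omega !mE /omega_vec.
rewrite rmorphM /= conjC_nat.
have -> : (sqrtC d^-1)^* = sqrtC d^-1.
  by apply/CrealP/ger0_real; rewrite sqrtC_ge0 invr_ge0 ler0n.
rewrite mulrACA -expr2 sqrtCK -natrM mulnb.
by case: (_ && _); rewrite ?mul1r ?mul0r.
Qed.

Lemma Omega_pairst p q :
  Omega V V' (pairst p) (pairst q) = ((p.1 == p.2) && (q.1 == q.2))%:R / d.
Proof.
rewrite OmegaE /omega_vec !pairstK rmorphM /= conjC_nat.
have -> : (sqrtC d^-1)^* = sqrtC d^-1.
  by apply/CrealP/ger0_real; rewrite sqrtC_ge0 invr_ge0 ler0n.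
by rewrite mulrACA -expr2 sqrtCK -natrM mulnb.
Qed.

Lemma effect_Omega : effect W (@Omega R V V').
Proof.
rewrite OmegaE; set w := omega_vec; split; first exact: psdF_rank1.
have ww : \sum_s w s * (w s)^* = 1.
  transitivity (\sum_s @Omega R V V' s s); first by rewrite OmegaE.
  rewrite sum_pairst -(pair_bigA _ (fun a b => Omega V V' (pairst (a, b)) (pairst (a, b)))) /=.
  transitivity (\sum_(a : st V) d^-1).
    apply: eq_bigr => a _; rewrite -[RHS](sum_pred1l _ a (fun=> d^-1)).
    by apply: eq_bigr => b _; rewrite Omega_pairst /= andbb eq_sym.
  by rewrite sumr_const card_st -[_ *+ _]mulr_natl divff // gt_eqF // d_gt0.
exact: psdF_id_sub_rank1.
Qed.

(** [E] acts on the [V] half and leaves the [V'] indices [p.2], [q.2] in place, while [Omega] keeps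
    only states with equal halves. Hence the single terms [(p.2, p.2)] and [(q.2, q.2)] survive. *)
Lemma adjS_Omega (E : @Op R V -> @Op R V) p q : linearS V E ->
  adjS W (extS V W E) (Omega V V') (pairst q) (pairst p) = choi V E p q / d.
Proof.
move=> lE.
have extE r r' : extS V W E (unitO W (pairst p) (pairst q)) (pairst r) (pairst r')
    = ((r.2 == p.2) && (r'.2 == q.2))%:R * E (unitO V p.1 q.1) r.1 r'.1.
  rewrite /extS !restr_pairst.
  (* The scalar is pulled out of [E] as a linear combination with one term. *)
  transitivity (E (fun s t => \sum_(i <- [:: tt])
     ((r.2 == p.2) && (r'.2 == q.2))%:R * unitO V p.1 q.1 s t) r.1 r'.1).
    congr (E _ _ _); apply/funext => s; apply/funext => t; rewrite big_seq1.
    rewrite !merge_pairst /unitO !(inj_eq pairst_inj) -natrM mulnb.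
    by case: p q => [a b] [a' b'] /=; rewrite !xpair_eqE andbACA andbC.
  by rewrite linearS_sum // big_seq1.
rewrite /adjS /trO /mulO sum_pairst (bigD1 (p.2, p.2)) //= [X in _ + X]big1 => [|r]; last first.
  move=> rp; rewrite sum_pairst big1 // => r' _; rewrite extE Omega_pairst.
  case: (r.2 =P p.2) => [r2|_]; last by rewrite /= !mul0r.
  case: (r.1 =P r.2) => [r1|]; last by rewrite andbF /= mul0r mulr0.
  by move: rp; rewrite -r2 {1}(surjective_pairing r) r1 eqxx.
rewrite addr0 sum_pairst (bigD1 (q.2, q.2)) //= [X in _ + X]big1 => [|r]; last first.
  move=> rq; rewrite extE Omega_pairst eqxx /=.
  case: (r.2 =P q.2) => [r2|_]; last by rewrite /= !mul0r.
  case: (r.1 =P r.2) => [r1|]; last by rewrite /= mul0r mulr0.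
  by move: rq; rewrite -r2 {1}(surjective_pairing r) r1 eqxx.
by rewrite addr0 extE Omega_pairst !eqxx !mul1r.
Qed.

Lemma tr_adjS_Omega (E : @Op R V -> @Op R V) (G : st V * st V -> st V * st V -> C) :
  linearS V E ->
  trO W (mulO W (adjS W (extS V W E) (Omega V V'))
    (fun s t => G (unpairst s) (unpairst t)))
  = (\sum_p \sum_q choi V E p q * G p q) / d.
Proof.
move=> lE; rewrite /trO /mulO sum_pairst exchange_big /= sum_pairst mulr_suml.
apply: eq_bigr => p _; rewrite mulr_suml; apply: eq_bigr => q _.
by rewrite !pairstK adjS_Omega //; ring.
Qed.

(** Positivity of the effect [E^dagger(Omega)], read through transposition and the factor [d]. *)
Lemma psdF_choi (E : @Op R V -> @Op R V) : DProg V E -> psdF (choi V E).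
Proof.
move=> DE; have [lE _] := DE.
have [pM _] := effect_adjS _ W _ _ DE (fsubsetUl V V') effect_Omega.
move=> v; have := psdF_comp _ _ pairst _ (psdF_tr _ _ pM) v.
have -> : sesq (fun s t => adjS W (extS V W E) (Omega V V') (pairst t) (pairst s)) v v
    = sesq (choi V E) v v / d.
  rewrite /sesq mulr_suml; apply: eq_bigr => s _; rewrite mulr_suml.
  by apply: eq_bigr => t _; rewrite adjS_Omega //; ring.
by rewrite pmulr_lge0 // invr_gt0 d_gt0.
Qed.

(** The diagonal of the effect [E^dagger(Omega)] is at most 1. This makes the set of Choi matrices
    bounded. *)
Lemma choi_diag_le (E : @Op R V -> @Op R V) p : DProg V E -> choi V E p p <= d.
Proof.
move=> DE; have [lE _] := DE.
have [_ pM] := effect_adjS _ W _ _ DE (fsubsetUl V V') effect_Omega.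
have := psdF_diag _ _ (pairst p) pM.
rewrite /subO /idOp eqxx subr_ge0 adjS_Omega //.
by rewrite ler_pdivrMr ?d_gt0 // mul1r.
Qed.

End Pairing.

(** * Hermitian matrices as a real Euclidean space *)

Section HermitianCoordinates.
Context {R : realType} {I : finType}.
Notation C := R[i].
Implicit Types (A B : I -> I -> C) (x : I * I -> R) (v w : I -> C).

Definition herm A : Prop := forall s t, A t s = (A s t)^*.

(* The sum of real and imaginary part is an isometry from the Hermitian
   matrices onto the real functions on [I * I]: the cross terms are
   antisymmetric. *)
Definition hcoord A : I * I -> R :=
  fun p => complex.Re (A p.1 p.2) + complex.Im (A p.1 p.2).

(** The inverse of [hcoord]: the symmetric part of [x] is the real part, the antisymmetric part the
    imaginary one. *)
Definition hmat x : I -> I -> C := fun s t =>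
  Complex ((x (s, t) + x (t, s)) / 2) ((x (s, t) - x (t, s)) / 2).

Definition rank1 v : I -> I -> C := fun s t => v s * (v t)^*.

Lemma herm_hmat x : herm (hmat x).
Proof.
move=> s t; apply/eqP; rewrite eq_complex /=; apply/andP; split; apply/eqP; ring.
Qed.

Lemma herm_rank1 v : herm (rank1 v).
Proof. by move=> s t; rewrite /rank1 rmorphM /= conjCK mulrC. Qed.

Lemma hmatK x : hcoord (hmat x) = x.
Proof. by apply/funext => -[s t]; rewrite /hcoord /=; field. Qed.

Lemma hcoordK A : herm A -> hmat (hcoord A) = A.
Proof.
move=> hA; apply/funext => s; apply/funext => t; rewrite /hmat /hcoord /=.
rewrite (hA s t); case: (A s t) => a b; apply/eqP.
by rewrite eq_complex /=; apply/andP; split; apply/eqP; field.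
Qed.

Lemma sum_antisym (f : I -> I -> C) :
  (forall s t, f t s = - f s t) -> \sum_s \sum_t f s t = 0.
Proof.
move=> fN; have : \sum_s \sum_t f s t = - \sum_s \sum_t f s t.
  rewrite {1}exchange_big -sumrN; apply: eq_bigr => s _ /=.
  by rewrite -sumrN; apply: eq_bigr => t _; rewrite fN.
move=> /eqP; rewrite -subr_eq0 opprK -mulr2n -mulr_natr mulf_eq0 pnatr_eq0 orbF.
by move=> /eqP.
Qed.

(** The entrywise defect [k] consists of the cross terms and the imaginary part; for Hermitian
    matrices both change sign when the indices are swapped. *)
Lemma herm_pairing A B : herm A -> herm B ->
  \sum_s \sum_t A s t * (B s t)^* = (dotR (hcoord A) (hcoord B))%:C%C.
Proof.
move=> hA hB.
pose k s t : C := A s t * (B s t)^* - (hcoord A (s, t) * hcoord B (s, t))%:C%C.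
have k0 : \sum_s \sum_t k s t = 0.
  apply: sum_antisym => s t; rewrite /k /hcoord /= hA hB.
  case: (A s t) => a b; case: (B s t) => c e; apply/eqP.
  by rewrite eq_complex /=; apply/andP; split; apply/eqP; ring.
rewrite /dotR -(pair_bigA _ (fun s t => hcoord A (s, t) * hcoord B (s, t))) /=.
apply/eqP; rewrite -subr_eq0 rmorph_sum -sumrB -[X in _ == X]k0; apply/eqP.
by apply: eq_bigr => s _; rewrite rmorph_sum -sumrB.
Qed.

Lemma sesq_hcoord A v : herm A ->
  sesq A v v = (dotR (hcoord A) (hcoord (rank1 v)))%:C%C.
Proof.
move=> hA; rewrite -herm_pairing //; last exact: herm_rank1.
apply: eq_bigr => s _; apply: eq_bigr => t _.
by rewrite /rank1 rmorphM /= conjCK; ring.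
Qed.

Definition rank1_cone : set (I * I -> R) := [set hcoord (rank1 v) | v in setT].

(** The form of [A] at [v] is its inner product with the rank-one matrix of [v], so positivity is
    membership in the dual cone of the rank-one matrices. *)
Lemma psdF_dual_cone A : herm A -> psdF A <-> dual_cone rank1_cone (hcoord A).
Proof.
move=> hA; split=> [pA _ [v _ <-]|dA v]; rewrite ?sesq_hcoord //.
  by have := pA v; rewrite sesq_hcoord // ler0c.
by rewrite ler0c; apply: dA; exists v.
Qed.

Lemma rank1_cone_ge0 x y : rank1_cone x -> rank1_cone y -> 0 <= dotR x y.
Proof.
move=> [v _ <-]; move: y; apply/psdF_dual_cone; first exact: herm_rank1.
exact: psdF_rank1.
Qed.

Lemma hcoord_le A (c : R) : psdF A -> (forall s, A s s <= c%:C%C) ->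
  forall p, `|hcoord A p| <= 2 * c.
Proof.
move=> pA dA [s t]; rewrite /hcoord /=.
(* For [b = 1 - i] the real part of [b * A s t] is the coordinate itself. The form at [e_s + b e_t]
   and [e_s - b e_t] bounds its absolute value by [(A s s + 2 A t t) / 2], hence by [2 * c]. *)
have := psdF_pair _ _ s t 1 (Complex (-1) 1) pA.
have := psdF_pair _ _ s t 1 (Complex 1 (-1)) pA.
have := dA s; have := dA t; have := psdF_diag _ _ s pA; have := psdF_diag _ _ t pA.
rewrite (psdF_herm _ _ pA s t).
case: (A s s) => a a'; case: (A t t) => b b'; case: (A s t) => x y.
rewrite !lecE /= => /andP[/eqP b0 bp] /andP[/eqP a0 ap].
rewrite b0 a0 => /andP[_ bc] /andP[_ ac] /andP[_ h1] /andP[_ h2].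
by rewrite ler_norml; apply/andP; split; lra.
Qed.

End HermitianCoordinates.

(** * Convergence of complex sequences *)

Section CvgComplex.
Context {R : realType}.

Lemma cvgC_cst (z : R[i]) : cvgC (fun=> z) z.
Proof. by split; exact: cvg_cst. Qed.

Lemma cvgC_add u v (a b : R[i]) : cvgC u a -> cvgC v b ->
  cvgC (fun n => u n + v n) (a + b).
Proof.
move=> [ur ui] [vr vi].
have ReD (x y : R[i]) : complex.Re (x + y) = complex.Re x + complex.Re y.
  by case: x y => ? ? [].
have ImD (x y : R[i]) : complex.Im (x + y) = complex.Im x + complex.Im y.
  by case: x y => ? ? [].
split; under eq_fun do rewrite ?ReD ?ImD; rewrite ?ReD ?ImD; exact: cvgD.
Qed.

Lemma cvgC_scale u (a c : R[i]) : cvgC u a -> cvgC (fun n => c * u n) (c * a).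
Proof.
move=> [ur ui].
have ReM (x y : R[i]) : complex.Re (x * y)
    = complex.Re x * complex.Re y - complex.Im x * complex.Im y.
  by case: x y => ? ? [].
have ImM (x y : R[i]) : complex.Im (x * y)
    = complex.Re x * complex.Im y + complex.Im x * complex.Re y.
  by case: x y => ? ? [].
split; under eq_fun do rewrite ?ReM ?ImM; rewrite ?ReM ?ImM.
  by apply: cvgB; apply: cvgM => //; exact: cvg_cst.
by apply: cvgD; apply: cvgM => //; exact: cvg_cst.
Qed.

Lemma cvgC_sum (J : Type) (r : seq J) (u : J -> nat -> R[i]) a :
  (forall j, cvgC (u j) (a j)) ->
  cvgC (fun n => \sum_(j <- r) u j n) (\sum_(j <- r) a j).
Proof.
move=> ua; elim: r => [|j r IH].
  by under eq_fun do rewrite big_nil; rewrite big_nil; exact: cvgC_cst.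
by under eq_fun do rewrite big_cons; rewrite big_cons; exact: cvgC_add.
Qed.

End CvgComplex.

(** * Minimax for Choi matrices *)

(** The minimax lemma is applied to the coordinates of [e] times the differences of Choi matrices:
    [e = 1] yields [J_E <= J_F], [e = -1] the reverse. The limit is realised in [EE] by
    closedness. *)
Lemma exists_choi_order (R : realType) (V : {fset nat})
    (EE : set (@Op R V -> @Op R V)) (F : @Op R V -> @Op R V) (e c : R) :
  NProg V EE -> e * e = 1 ->
  (forall E : @Op R V -> @Op R V, DProg V E -> psdF (choi V E)) ->
  (forall E : @Op R V -> @Op R V, DProg V E -> forall p, choi V E p p <= c%:C%C) -> DProg V F ->
  (forall G : st V * st V -> st V * st V -> R[i], psdF G -> forall d, 0 < d -> exists2 E, EE E &
    - d <= e * complex.Re (\sum_p \sum_q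
             (choi V F p q - choi V E p q) * (G p q)^*)) ->
  exists2 E, EE E & psdF (fun p q => e%:C%C * (choi V F p q - choi V E p q)).
Proof.
move=> [EED [_ [EEconv EEclosed]]] ee Jpsd Jbnd DF hG.
have Jherm (E : @Op R V -> @Op R V) : DProg V E -> herm (choi V E) by move=> DE; exact: psdF_herm _ _ (Jpsd E DE).
pose D (E : @Op R V -> @Op R V) p q := e%:C%C * (choi V F p q - choi V E p q).
have Dherm E : EE E -> herm (D E).
  move=> /EED DE p q; rewrite /D (Jherm F DF p q) (Jherm E DE p q).
  by rewrite rmorphM rmorphB /= [(e%:C%C)^*]conjc_real.
have hcD E t : hcoord (D E) t = e * (hcoord (choi V F) t - hcoord (choi V E) t).
  rewrite /hcoord /D; case: (choi V F _ _) => a b; case: (choi V E _ _) => a' b' /=.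
  by ring.
pose K : set _ := [set hcoord (D E) | E in EE].
have Kconv : convexR K.
  move=> _ _ p [E1 EE1 <-] [E2 EE2 <-] p01.
  eexists; first exact: (EEconv E1 E2 p EE1 EE2 p01).
  apply/funext => t; rewrite !hcD /hcoord /choi.
  case: (E1 _ _ _) => a1 b1; case: (E2 _ _ _) => a2 b2.
  by case: (F _ _ _) => a b /=; ring.
(* Each Choi coordinate is at most [2 * c] in absolute value, so a difference is at most [4 * c]. *)
have Kbnd x : K x -> dotR x x <=
    \sum_(t : (st V * st V) * (st V * st V)) (4 * c) * (4 * c).
  move=> [E EEE <-]; apply: ler_sum => t _; rewrite hcD.
  have := hcoord_le _ _ (Jpsd E (EED _ EEE)) (Jbnd E (EED _ EEE)) t.
  have := hcoord_le _ _ (Jpsd F DF) (Jbnd F DF) t.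
  move: (hcoord _ t) (hcoord _ t) => a b; rewrite !ler_norml.
  move=> /andP[a1 a2] /andP[b1 b2]; rewrite mulrACA ee mul1r.
  have : 0 <= (4 * c - (a - b)) * (4 * c + (a - b)) by apply: mulr_ge0; lra.
  by lra.
have [|x_ [z [xK xz zdual]]] :=
    self_dual_minimax R _ K rank1_cone _ Kconv Kbnd rank1_cone_ge0.
  move=> r d rd d0.
  have pG : psdF (hmat r).
    by apply/psdF_dual_cone; [exact: herm_hmat | rewrite hmatK].
  have [E EEE hE] := hG _ pG d d0; exists (hcoord (D E)); first by exists E.
  rewrite -(hmatK r).
  have := herm_pairing _ _ (Dherm E EEE) (herm_hmat r).
  have -> : \sum_s \sum_t D E s t * (hmat r s t)^* = e%:C%C *
     \sum_p \sum_q (choi V F p q - choi V E p q) * (hmat r p q)^*.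
    rewrite mulr_sumr; apply: eq_bigr => s _; rewrite mulr_sumr.
    by apply: eq_bigr => t _; rewrite /D mulrA.
  move=> /(congr1 (@complex.Re R)) /= <-.
  by move: hE; case: (\sum_p _) => a b /=; rewrite mul0r subr0.
have /choice[E_ E_P] : forall n, exists E, EE E /\ hcoord (D E) = x_ n.
  by move=> n; have [E EEE EK] := xK n; exists E.
(* The coordinates of the limiting Choi matrix, solved from [z = e * (hcoord (choi V F) - y)] by
   [e * e = 1]. *)
pose y t := hcoord (choi V F) t - e * z t.
have yE n t : hcoord (choi V (E_ n)) t = hcoord (choi V F) t - e * x_ n t.
  by have [_ <-] := E_P n; rewrite hcD mulrA ee; ring.
have ycvg t : (fun n => hcoord (choi V (E_ n)) t) @ \oo --> y t.
  under eq_fun do rewrite yE; apply: cvgB; first exact: cvg_cst.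
  by apply: cvgM => //; exact: cvg_cst.
have Jcvg p q : cvgC (fun n => choi V (E_ n) p q) (hmat y p q).
  have -> : (fun n => choi V (E_ n) p q)
      = (fun n => hmat (hcoord (choi V (E_ n))) p q).
    by apply/funext => n; rewrite hcoordK //; apply/Jherm/EED; case: (E_P n).
  split; rewrite /hmat /=; apply: cvgM; try exact: cvg_cst.
    exact: cvgD.
  exact: cvgB.
(* The super-operator with Choi matrix [hmat y], which is the pointwise limit of the [E_ n]. *)
pose E : @Op R V -> @Op R V := fun A s t =>
  \sum_(p : st V * st V) A p.1 p.2 * hmat y (p.1, s) (p.2, t).
have EEE : EE E.
  apply: (EEclosed E_) => [n|A s t]; first by case: (E_P n).
  have -> : (fun n => E_ n A s t) = (fun n => \sum_(p : st V * st V)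
      A p.1 p.2 * choi V (E_ n) (p.1, s) (p.2, t)).
    apply/funext => n; rewrite linearS_unit //.
    by have [/EED[]] := E_P n.
  by apply: cvgC_sum => p; exact: cvgC_scale.
have JE : choi V E = hmat y.
  apply/funext => -[a s]; apply/funext => -[b t]; rewrite /choi /E /=.
  rewrite (bigD1 (a, b)) //= /unitO !eqxx mul1r big1 ?addr0 // => -[a' b'].
  by rewrite xpair_eqE /= => /negPf ->; rewrite mul0r.
exists E => //; apply/(psdF_dual_cone _ (Dherm E EEE)).
suff -> : hcoord (D E) = z by [].
by apply/funext => t; rewrite hcD JE hmatK /y opprB addrC subrK mulrA ee mul1r.
Qed.

(** * Demonic expectations and their monotonicity *)

Section Expectation.
Context {R : realType}.

Lemma ReB (x y : R[i]) : complex.Re (x - y) = complex.Re x - complex.Re y.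
Proof. by case: x y => ? ? []. Qed.

Lemma Re_scale (k : R) (x : R[i]) : complex.Re (k%:C%C * x) = k * complex.Re x.
Proof. by case: x => a b /=; rewrite mul0r subr0. Qed.

Lemma Re_ge0 (x : R[i]) : 0 <= x -> 0 <= complex.Re x.
Proof. by rewrite lecE => /andP[]. Qed.

Lemma Re_le (x y : R[i]) : x <= y -> complex.Re x <= complex.Re y.
Proof. by rewrite lecE => /andP[]. Qed.

Lemma ext_id (W : {fset nat}) (M : @Op R W) : ext W W M = M.
Proof.
apply/funext => s; apply/funext => t; rewrite /ext !restr_id ifT //.
by apply/forallP => x; rewrite (valP x).
Qed.

Lemma tr_ext_compl (W X : {fset nat}) (M : @Op R W) (rho : @Op R X) :
  fsubset W X ->
  complex.Re (trO X (mulO X (ext W X (subO W (idOp W) M)) rho))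
  = complex.Re (trO X rho) - complex.Re (trO X (mulO X (ext W X M) rho)).
Proof.
by move=> WX; rewrite !tr_ext // trO_mulO_sub ReB -trO_ptr.
Qed.

Lemma tr_mulO_subr (X : {fset nat}) (A B B' : @Op R X) :
  trO X (mulO X A (subO X B B')) = trO X (mulO X A B) - trO X (mulO X A B').
Proof.
rewrite /trO -sumrB; apply: eq_bigr => s _; rewrite /mulO -sumrB.
by apply: eq_bigr => t _; rewrite /subO mulrBr.
Qed.

Lemma tr_ext_ge0 (W X : {fset nat}) (M : @Op R W) (rho : @Op R X) :
  psd W M -> psd X rho ->
  0 <= complex.Re (trO X (mulO X (ext W X M) rho)).
Proof.
by move=> pM pr; apply/Re_ge0/trO_mul_ge0 => //; exact: psd_ext.
Qed.

Lemma trO_ge0 (X : {fset nat}) (rho : @Op R X) :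
  psd X rho -> 0 <= complex.Re (trO X rho).
Proof.
move=> pr; apply/Re_ge0; apply: sumr_ge0 => s _.
exact: (psdF_diag _ (rho : st X -> st X -> R[i])).
Qed.

Lemma ExpDem_set1 (W X : {fset nat}) (M : @Op R W) (rho : @Op R X) :
  ExpDem X W rho [set M] = complex.Re (trO X (mulO X (ext W X M) rho)).
Proof.
rewrite /ExpDem; case: asboolP => [e|_]; last by rewrite image_set1 inf1.
by have : [set M] M by []; rewrite e.
Qed.

Lemma ExpDem_lbound (W X : {fset nat}) (rho : @Op R X) (Psi : set (@Op R W)) c :
  Psi !=set0 ->
  (forall N, Psi N -> c <= complex.Re (trO X (mulO X (ext W X N) rho))) ->
  c <= ExpDem X W rho Psi.
Proof.
move=> Psi0 cN; rewrite /ExpDem asboolF => [|e]; last first.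
  by move: Psi0; rewrite e => -[].
apply: lb_le_inf; first by have [N PN] := Psi0; eexists; exists N.
by move=> _ [N PN <-]; exact: cN.
Qed.

Lemma ExpDem_le (W X : {fset nat}) (rho : @Op R X) (Psi : set (@Op R W)) N :
  Psi `<=` effect W -> psd X rho -> Psi N ->
  ExpDem X W rho Psi <= complex.Re (trO X (mulO X (ext W X N) rho)).
Proof.
move=> Peff pr PN; rewrite /ExpDem asboolF => [|e]; last by rewrite e in PN.
apply: ge_inf; last by exists N.
by exists 0 => _ [M /Peff[pM _] <-]; exact: tr_ext_ge0.
Qed.

Lemma ExpDem_ge0 (W X : {fset nat}) (rho : @Op R X) (Psi : set (@Op R W)) :
  Psi `<=` effect W -> psd X rho -> 0 <= ExpDem X W rho Psi.
Proof.
move=> Peff pr; have [->|/set0P Psi0] := eqVneq Psi set0.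
  by rewrite /ExpDem asboolT //; exact: trO_ge0.
by apply: ExpDem_lbound => // N /Peff[pN _]; exact: tr_ext_ge0.
Qed.

Lemma ExpDem_mono (W X : {fset nat}) (rho sigma : @Op R X) (Psi : set (@Op R W)) :
  Psi `<=` effect W -> psd X rho -> psd X (subO X sigma rho) ->
  ExpDem X W rho Psi <= ExpDem X W sigma Psi.
Proof.
move=> Peff pr prs; have [->|/set0P Psi0] := eqVneq Psi set0.
  rewrite /ExpDem asboolT // -subr_ge0 -ReB.
  by rewrite /trO -sumrB; exact: (trO_ge0 _ _ prs).
apply: ExpDem_lbound => // N PN; apply: le_trans (ExpDem_le _ _ _ _ N Peff pr PN) _.
rewrite -subr_ge0 -ReB -tr_mulO_subr; apply: tr_ext_ge0 => //.
by have [] := Peff N PN.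
Qed.

(** [tr (N rho) - tr rho] is minus the trace of the effect [I - N] against [rho], hence decreasing
    in [rho]; for empty [Psi] both sides are 0. *)
Lemma ExpDem_sub_mono (W X : {fset nat}) (rho sigma : @Op R X)
    (Psi : set (@Op R W)) : fsubset W X ->
  Psi `<=` effect W -> psd X sigma -> psd X (subO X sigma rho) ->
  ExpDem X W sigma Psi - complex.Re (trO X sigma)
  <= ExpDem X W rho Psi - complex.Re (trO X rho).
Proof.
move=> WX Peff pr prs; have [->|/set0P Psi0] := eqVneq Psi set0.
  by rewrite /ExpDem asboolT // !subrr.
rewrite lerBrDr; apply: ExpDem_lbound => // N PN.
have := ExpDem_le _ _ _ _ N Peff pr PN.
have [_ pN] := Peff N PN.
have := tr_ext_ge0 _ _ _ _ pN prs; rewrite tr_mulO_subr ReB !tr_ext_compl //; lra.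
Qed.

End Expectation.

(** * Characteristic formulas and refinement *)

Section Refinement.
Context {R : realType} {V V' : {fset nat}}.
Hypotheses (cV : #|` V'|%fset = #|` V|%fset) (dV : (V `&` V')%fset = fset0).
Notation W := (V `|` V')%fset.
Notation SOp := (@Op R V -> @Op R V).
Notation trOm E rho := (complex.Re (trO W (mulO W (adjS W (extS V W E)
  (@Omega R V V')) rho))).

(** Passes from states to Choi matrices and back: a positive test matrix becomes, after scaling, a
    density operator on [W], and the resulting Choi order says that [e] times [F - E] is completely
    positive. *)
Lemma exists_cp_order (EE : set SOp) (F : SOp) (e : R) :
  NProg V EE -> DProg V F -> e * e = 1 ->
  (forall rho : @Op R W, density W rho -> forall d, 0 < d ->
    exists2 E, EE E & - d <= e * (trOm F rho - trOm E rho)) ->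
  exists2 E, EE E & forall X (rho : @Op R X), psd X rho ->
    psd X (fun s t => e%:C%C * (extS V X F rho s t - extS V X E rho s t)).
Proof.
move=> NE DF ee hrho; have [EED _] := NE.
pose n : R := (2 ^ #|` V|)%N%:R.
have nC : n%:C%C = (2 ^ #|` V|)%N%:R :> R[i] by rewrite rmorph_nat.
have n0 : 0 < n by rewrite ltr0n expn_gt0.
have Jle (E : SOp) : DProg V E -> forall p, choi V E p p <= n%:C%C.
  by move=> DE p; rewrite nC; exact: (choi_diag_le cV dV).
have [|E EEE pJ] := exists_choi_order R V EE F e n NE ee
    (psdF_choi cV dV) Jle DF.
  move=> G pG d d0.
  pose tau := complex.Re (\sum_p G p p).
  have trG0 : 0 <= \sum_p G p p by apply: sumr_ge0 => p _; exact: psdF_diag.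
  have tau0 : 0 <= tau by exact: Re_ge0.
  have tauC : tau%:C%C = \sum_p G p p.
    by rewrite RRe_real //; exact: ger0_real.
  (* The added 1 keeps [k] positive and meaningful for [G = 0], while the scaled trace [k * tau]
     stays at most 1. *)
  pose k := (1 + tau)^-1.
  have k0 : 0 < k by rewrite invr_gt0; lra.
  (* The conjugate of [G] compensates the transposition between [E^dagger(Omega)] and the Choi
     matrix. *)
  have [rho rhoE] : exists rho : @Op R W, rho = fun s t =>
      k%:C%C * (G (unpairst s) (unpairst t))^* by eexists.
  have drho : density W rho.
    split.
      move=> v; have := psdF_comp _ _ unpairst _ (psdF_tr _ _ pG) v.
      rewrite -(pmulr_rge0 (x := k%:C%C)) ?ltcR //; congr (0 <= _).
      rewrite /sesq mulr_sumr; apply: eq_bigr => s _.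
      rewrite mulr_sumr; apply: eq_bigr => t _.
      by rewrite rhoE (psdF_herm _ _ pG); ring.
    have -> : trO W rho = (k * tau)%:C%C.
      rewrite rmorphM /= tauC /trO (sum_pairst cV dV) mulr_sumr.
      apply: eq_bigr => p _; rewrite rhoE (pairstK cV dV).
      by rewrite -(psdF_herm _ _ pG).
    by rewrite -[1]/(1%:C%C) lecR /k mulrC ler_pdivrMr ?mul1r; lra.
  (* The traces against [rho] are [k / n] times the pairings with [G], so the tolerance scales
     alike. *)
  have dk : 0 < d * k / n by rewrite divr_gt0 // mulr_gt0.
  have [E EEE hE] := hrho rho drho _ dk; exists E => //.
  move: hE; rewrite -ReB rhoE.
  have [lF _] := DF; have [lE _] := EED _ EEE.
  rewrite (tr_adjS_Omega cV dV _ (fun p q => k%:C%C * (G p q)^*)) //.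
  rewrite (tr_adjS_Omega cV dV _ (fun p q => k%:C%C * (G p q)^*)) //.
  have -> : (\sum_p \sum_q choi V F p q * (k%:C%C * (G p q)^*)) / (2 ^ #|` V|)%N%:R
      - (\sum_p \sum_q choi V E p q * (k%:C%C * (G p q)^*)) / (2 ^ #|` V|)%N%:R
      = (k / n)%:C%C * \sum_p \sum_q (choi V F p q - choi V E p q) * (G p q)^*.
    have -> : (k / n)%:C%C = k%:C%C * (2 ^ #|` V|)%N%:R^-1 :> R[i].
      by rewrite -nC -fmorphV -rmorphM.
    rewrite -mulrBl -sumrB [RHS]mulrC mulrA; congr (_ * _).
    rewrite mulr_suml; apply: eq_bigr => p _.
    rewrite -sumrB mulr_suml; apply: eq_bigr => q _; ring.
  rewrite Re_scale; move: (complex.Re _) => x.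
  have kn : 0 < k / n by rewrite divr_gt0.
  have -> : e * (k / n * x) = (k / n) * (e * x) by ring.
  have -> : - (d * k / n) = (k / n) * (- d) by ring.
  by rewrite ler_pM2l.
exists E => // X rho pr.
have [lF _] := DF; have [lE _] := EED _ EEE.
pose D : SOp := fun A s t => e%:C%C * (F A s t - E A s t).
have lD : linearS V D.
  move=> a A B; apply/funext => s; apply/funext => t; rewrite /D lF lE; ring.
exact: (psd_extS_choi _ X D rho lD pJ pr).
Qed.

Lemma wpS_effect (EE : set SOp) : NProg V EE ->
  wpS V W EE [set Omega V V'] `<=` effect W.
Proof.
move=> [EED _] _ [E [_ [EEE [-> ->]]]].
by apply: effect_adjS; [exact: EED | exact: fsubsetUl | exact: effect_Omega].
Qed.

Lemma complS_effect (Theta : set (@Op R W)) :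
  Theta `<=` effect W -> complS W Theta `<=` effect W.
Proof. by move=> Teff _ [M /Teff eM <-]; exact: effect_compl. Qed.

Lemma wpS_Omega_nonempty (EE : set SOp) : NProg V EE ->
  wpS V W EE [set Omega V V'] !=set0.
Proof. by move=> [_ [[E EEE] _]]; eexists; exists E, (Omega V V'). Qed.

Lemma tr_Omega_extS (X : {fset nat}) (E : SOp) (rho : @Op R X) :
  DProg V E -> fsubset W X ->
  trO X (mulO X (ext W X (adjS W (extS V W E) (Omega V V'))) rho)
  = trO X (mulO X (ext W X (Omega V V')) (extS V X E rho)).
Proof. by move=> [lE _] WX; rewrite tr_ext_adjS // fsubsetUl. Qed.

Lemma psd_extS (X : {fset nat}) (E : SOp) (rho : @Op R X) :
  DProg V E -> fsubset V X -> psd X rho -> psd X (extS V X E rho).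
Proof. by move=> [_ [cE _]] VX; exact: cE. Qed.

(** [EE] satisfies its own characteristic formula: for each [E] the effect [E^dagger(Omega)] is
    among those minimised over on the left. *)
Lemma models_tot_wpS (EE : set SOp) : NProg V EE ->
  models_tot V W EE (wpS V W EE [set Omega V V']) [set Omega V V'].
Proof.
move=> NE X VWX rho [pr _]; have [EED [[E0 EE0] _]] := NE.
have WX : fsubset W X by apply: fsubset_trans VWX; exact: fsubsetUr.
apply: lb_le_inf; first by eexists; exists E0.
move=> _ [E EEE <-]; rewrite ExpDem_set1 -tr_Omega_extS //; last exact: EED.
by apply: ExpDem_le => //; [exact: wpS_effect | exists E, (Omega V V')].
Qed.

(** [tr rho - tr (Omega E(rho))] equals the trace of [I - Omega] against [E(rho)] plus the lost
    trace, which is the correction in partial correctness. *)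
Lemma models_par_wlpS (EE : set SOp) : NProg V EE ->
  models_par V W EE (complS W (wpS V W EE [set Omega V V']))
    [set subO W (idOp W) (Omega V V')].
Proof.
move=> NE X VWX rho [pr _]; have [EED [[E0 EE0] _]] := NE.
have WX : fsubset W X by apply: fsubset_trans VWX; exact: fsubsetUr.
apply: lb_le_inf; first by eexists; exists E0.
move=> _ [E EEE <-]; rewrite ExpDem_set1 tr_ext_compl //.
rewrite -tr_Omega_extS //; last exact: EED.
apply: (@le_trans _ _ (complex.Re (trO X (mulO X (ext W X (subO W (idOp W)
    (adjS W (extS V W E) (Omega V V')))) rho)))).
  apply: ExpDem_le => //; first by apply: complS_effect; exact: wpS_effect.
  by eexists; first by exists E, (Omega V V').
by rewrite tr_ext_compl //; lra.
Qed.

Lemma inf_image_le (T : Type) (A : set T) (f : T -> R) x :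
  (forall y, A y -> 0 <= f y) -> A x -> inf [set f y | y in A] <= f x.
Proof.
by move=> f0 Ax; apply: ge_inf; [exists 0 => _ [y Ay <-]; exact: f0 | exists x].
Qed.

(** Supplies the lower bound that allows the infimum in partial correctness to be compared with its
    members. *)
Lemma par_ge0 (U X : {fset nat}) (E : SOp) (rho : @Op R X) (Psi : set (@Op R U)) :
  DProg V E -> fsubset V X -> psd X rho -> Psi `<=` effect U ->
  0 <= ExpDem X U (extS V X E rho) Psi + complex.Re (trO X rho)
       - complex.Re (trO X (extS V X E rho)).
Proof.
move=> DE VX pr Peff.
have := ExpDem_ge0 _ _ _ _ Peff (psd_extS _ _ _ DE VX pr).
have := Re_le _ _ (trace_nonincr_extS _ _ _ _ DE VX pr); lra.
Qed.

Lemma ExpDem_adherent (U X : {fset nat}) (rho : @Op R X) (Theta : set (@Op R U))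
    d : Theta `<=` effect U -> psd X rho -> Theta !=set0 -> 0 < d ->
  exists2 M, Theta M &
    complex.Re (trO X (mulO X (ext U X M) rho)) < ExpDem X U rho Theta + d.
Proof.
move=> Teff pr T0 d0; rewrite /ExpDem asboolF => [|e]; last first.
  by move: T0; rewrite e => -[].
have [|_ [M TM <-] Md] := @inf_adherent _ [set complex.Re (trO X (mulO X
    (ext U X M) rho)) | M in Theta] _ d0; last by exists M.
split; first by have [M TM] := T0; eexists; exists M.
by exists 0 => _ [M /Teff[pM _] <-]; exact: tr_ext_ge0.
Qed.

(** For each [F] there is an [E] in [EE] with [F - E] completely positive; every expectation after
    [E] is then at most the one after [F], on any larger system. *)
Lemma refT_of_models_tot (EE FF : set SOp) : NProg V EE -> NProg V FF ->
  models_tot V W FF (wpS V W EE [set Omega V V']) [set Omega V V'] ->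
  refT V EE FF.
Proof.
move=> NE NF mF U Theta Psi Teff Peff mE X VUX rho drho.
have [EED _] := NE; have [FFD [[F0 FF0] _]] := NF; have [pr _] := drho.
have VX : fsubset V X by apply: fsubset_trans VUX; exact: fsubsetUl.
apply: lb_le_inf; first by eexists; exists F0.
move=> _ [F FFF <-]; have DF := FFD _ FFF.
have [||E EEE EF] := exists_cp_order EE F 1 NE DF; first by rewrite mulr1.
  move=> sigma dsigma d d0; have [ps _] := dsigma.
  have [_ [E [_ [EEE [-> ->]]]] hE] := ExpDem_adherent _ _ _ _ _
    (wpS_effect _ NE) ps (wpS_Omega_nonempty _ NE) d0.
  exists E => //; rewrite mul1r; move: hE; rewrite ext_id.
  have VWW : fsubset (V `|` W)%fset W.
    by rewrite fsubUset fsubsetUl fsubset_refl.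
  have := mF W VWW sigma dsigma.
  have : inf [set ExpDem W W (extS V W F sigma) [set Omega V V'] | F in FF]
      <= trOm F sigma.
    rewrite -[adjS _ _ _]ext_id tr_Omega_extS ?fsubset_refl // -ExpDem_set1.
    apply: (@inf_image_le _ FF
      (fun F => ExpDem W W (extS V W F sigma) [set Omega V V'])) => // F' FF'.
    apply: ExpDem_ge0; first by move=> _ ->; exact: effect_Omega.
    by apply: psd_extS => //; [exact: FFD | exact: fsubsetUl].
  by lra.
apply: (@le_trans _ _ (ExpDem X U (extS V X E rho) Psi)).
  apply: le_trans (mE X VUX rho drho) _.
  apply: (@inf_image_le _ EE (fun E => ExpDem X U (extS V X E rho) Psi)) => // E' EE'.
  by apply: ExpDem_ge0 => //; apply: psd_extS => //; exact: EED.
apply: ExpDem_mono => //; first by apply: psd_extS => //; exact: EED.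
have := EF X rho pr; congr psd.
by apply/funext => s; apply/funext => t; rewrite mul1r.
Qed.

(** Here [E - F] is completely positive. The expectation minus the final trace decreases as the
    final state grows, so it is smaller after [E] than after [F]. *)
Lemma refP_of_models_par (EE FF : set SOp) : NProg V EE -> NProg V FF ->
  models_par V W FF (complS W (wpS V W EE [set Omega V V']))
    [set subO W (idOp W) (Omega V V')] ->
  refP V EE FF.
Proof.
move=> NE NF mF U Theta Psi Teff Peff mE X VUX rho drho.
have [EED _] := NE; have [FFD [[F0 FF0] _]] := NF; have [pr _] := drho.
have VX : fsubset V X by apply: fsubset_trans VUX; exact: fsubsetUl.
have UX : fsubset U X by apply: fsubset_trans VUX; exact: fsubsetUr.
apply: lb_le_inf; first by eexists; exists F0.
move=> _ [F FFF <-]; have DF := FFD _ FFF.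
have [||E EEE EF] := exists_cp_order EE F (-1) NE DF; first by rewrite mulrNN mulr1.
  move=> sigma dsigma d d0; have [ps _] := dsigma.
  have cne : complS W (wpS V W EE [set Omega V V']) !=set0.
    by have [M wM] := wpS_Omega_nonempty _ NE; eexists; exists M.
  have [_ [_ [E [_ [EEE [-> ->]]]] <-] hE] := ExpDem_adherent _ _ _ _ _
    (complS_effect _ (wpS_effect _ NE)) ps cne d0.
  exists E => //; rewrite mulN1r; move: hE.
  (* With the complements expanded, [tr sigma] occurs on both sides and cancels, which reverses the
     inequality between the effects. *)
  rewrite tr_ext_compl ?fsubset_refl // ext_id.
  have VWW : fsubset (V `|` W)%fset W.
    by rewrite fsubUset fsubsetUl fsubset_refl.
  have := mF W VWW sigma dsigma.
  have nonneg F' : FF F' -> 0 <= ExpDem W W (extS V W F' sigma)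
      [set subO W (idOp W) (Omega V V')] + complex.Re (trO W sigma)
      - complex.Re (trO W (extS V W F' sigma)).
    move=> FF'; apply: par_ge0; [exact: FFD | exact: fsubsetUl | by [] |].
    by move=> _ ->; apply: effect_compl; exact: effect_Omega.
  have := inf_image_le _ _ _ _ nonneg FFF.
  rewrite ExpDem_set1 tr_ext_compl ?fsubset_refl //.
  rewrite -tr_Omega_extS ?fsubset_refl // ext_id.
  by lra.
apply: (@le_trans _ _ (ExpDem X U (extS V X E rho) Psi + complex.Re (trO X rho)
    - complex.Re (trO X (extS V X E rho)))).
  apply: le_trans (mE X VUX rho drho) _.
  apply: (@inf_image_le _ EE (fun E => ExpDem X U (extS V X E rho) Psi
    + complex.Re (trO X rho) - complex.Re (trO X (extS V X E rho)))) => // E' EE'.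
  by apply: par_ge0 => //; exact: EED.
have pEF : psd X (subO X (extS V X E rho) (extS V X F rho)).
  have := EF X rho pr; congr psd.
  by apply/funext => s; apply/funext => t; rewrite rmorphN1 mulN1r opprB.
have := ExpDem_sub_mono _ _ _ _ _ UX Peff (psd_extS _ _ _ (EED _ EEE) VX pr) pEF.
by lra.
Qed.

End Refinement.

Theorem theorem5p3 (R : realType) (V V' : {fset nat})
  (EE FF : set (@Op R V -> @Op R V)) :
  NProg V EE -> NProg V FF ->
  #|` V'|%fset = #|` V|%fset -> (V `&` V')%fset = fset0 ->
  (refT V EE FF <->
     models_tot V (V `|` V')%fset FF (wpS V (V `|` V')%fset EE [set Omega V V']) [set Omega V V'])
  /\
  (refP V EE FF <->
     models_par V (V `|` V')%fset FF (complS (V `|` V')%fset (wpS V (V `|` V')%fset EE [set Omega V V']))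
                [set (subO (V `|` V')%fset (idOp (V `|` V')%fset) (Omega V V'))]).
Proof.
move=> NE NF cV dV; have eO := @effect_Omega R V V' cV dV.
have eWP := wpS_effect cV dV EE NE.
split; split.
(* Refinement transfers to [FF] the characteristic formula that [EE] itself satisfies. *)
- by move=> rT; apply: rT => //; [move=> _ -> | exact: models_tot_wpS].
- exact: refT_of_models_tot.
- move=> rP; apply: rP; first exact: complS_effect.
    by move=> _ ->; exact: effect_compl.
  exact: models_par_wlpS.
- exact: refP_of_models_par.
Qed.
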